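(* Let $f\colon[0,\infty)\times\mathbb{N}_0\to[0,\infty)$ satisfy $|f(\lambda,y)-f(\lambda',y')|\le \kappa_1|\lambda-\lambda'|+\kappa_2|y-y'|$ for all $\lambda,\lambda'\ge0$, $y,y'\in\mathbb{N}_0$, with constants $\kappa_1,\kappa_2\ge0$, $\kappa:=\kappa_1+\kappa_2<1$. Let $((N_t,\lambda_t))_{t\in\mathbb{Z}}$ be a strictly stationary process (in its stationary regime) with values in $\mathbb{N}_0\times[0,\infty)$ such that for all $t$, $N_t$ conditionally on $\sigma(\lambda_s,N_s: s\le t-1)$ (together with $\lambda_t$) is $\mathrm{Poisson}(\lambda_t)$ distributed, and $\lambda_t=f(\lambda_{t-1},N_{t-1})$. Then: (i) the count process $(N_t)_{t\in\mathbb{Z}}$ is absolutely regular, with coefficients satisfying $\beta(n)\le 2E\lambda_1\,\kappa^{n-1}/(1-\kappa_1)$ for all $n\in\mathbb{N}$; (ii) there is a measurable function $g\colon\mathbb{N}_0^\infty\to[0,\infty)$ such that $\lambda_t=g(N_{t-1},N_{t-2},\dots)$ almost surely for all $t\in\mathbb{Z}$; (iii) the process $((N_t,\lambda_t))_{t\in\mathbb{Z}}$ is ergodic; (iv) $E\lambda_1^2<\infty$.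
   Context: For $-\infty\le k\le l\le\infty$ let $\mathcal{B}^N_{k,l}=\sigma(N_k,\dots,N_l)$. The absolute regularity ($\beta$-mixing) coefficients of $(N_t)$ are $\beta(n)=E\big[\sup_{A\in\mathcal{B}^N_{n,\infty}}|P(A\mid\mathcal{B}^N_{-\infty,0})-P(A)|\big]$; the process is absolutely regular if $\beta(n)\to0$. $\mathbb{N}_0^\infty$ is the set of sequences $(n_1,n_2,\dots)$ with $n_i\in\mathbb{N}_0$, with the product $\sigma$-field. *)

(* Defs.v *)
From HB Require Import structures.
From mathcomp Require Import all_boot all_order all_algebra.
From mathcomp Require Import all_classical all_reals all_analysis.

Set Implicit Arguments.
Unset Strict Implicit.
Unset Printing Implicit Defensive.

Import Order.TTheory GRing.Theory Num.Theory.
Import numFieldNormedType.Exports.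
Local Open Scope classical_set_scope.
Local Open Scope ring_scope.

Section Defs.
Context {d : measure_display} {Omega : measurableType d} {R : realType}.

Definition Poisson_pmf_at (l : R) (k : nat) : R := expR (- l) * l ^+ k / (k`!)%:R.

Definition gen_sigma (N : int -> Omega -> nat) (lam : int -> Omega -> R)
  (IN IL : set int) : set (set Omega) :=
  <<s [set A | exists s m, IN s /\ A = N s @^-1` [set m]] `|`
      [set A | exists s (B : set R), IL s /\ measurable B /\ A = lam s @^-1` B] >>.

Definition past_sigma (N : int -> Omega -> nat) : set (set Omega) :=
  <<s [set A | exists (s : int) m, s <= 0 /\ A = N s @^-1` [set m]] >>.

Definition sub_measurable (G : set (set Omega)) (h : Omega -> R) : Prop :=
  forall B : set R, measurable B -> G (h @^-1` B).

End Defs.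

Definition seq_sigma : set (set (nat -> nat)) :=
  <<s [set A | exists (i k : nat), A = [set x | x i = k]] >>.

Definition path_sigma {R : realType} : set (set (int -> nat * R)) :=
  <<s [set A | exists (t : int) (k : nat), A = [set x | (x t).1 = k]] `|`
      [set A | exists (t : int) (B : set R), measurable B /\ A = [set x | B (x t).2]] >>.

Section Defs2.
Context {d : measure_display} {Omega : measurableType d} {R : realType}.
Variable P : probability Omega R.

Definition future (N : int -> Omega -> nat) (n : nat) : Omega -> (nat -> nat) :=
  fun w i => N (n%:Z + i%:Z) w.

Definition is_rcd (N : int -> Omega -> nat) (n : nat)
  (Q : Omega -> set (nat -> nat) -> R) : Prop :=
  [/\ (forall w, Q w setT = 1),
      (forall w C, seq_sigma C -> 0 <= Q w C),
      (forall w (F : nat -> set (nat -> nat)), (forall i, seq_sigma (F i)) ->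
          trivIset setT F ->
          (fun m => \sum_(i < m) Q w (F i)) @ \oo --> Q w (\bigcup_i F i)),
      (forall C, seq_sigma C -> sub_measurable (past_sigma N) (fun w => Q w C)) &
      (forall C B, seq_sigma C -> past_sigma N B ->
          (\int[P]_(w in B) (Q w C)%:E = P (B `&` future N n @^-1` C))%E)].

(* sup_{A in B^N_{n,oo}} | P(A | B^N_{-oo,0}) - P(A) |, computed with the
   regular version Q *)
Definition beta_sup (N : int -> Omega -> nat) (n : nat)
  (Q : Omega -> set (nat -> nat) -> R) (w : Omega) : \bar R :=
  ereal_sup [set abse ((Q w C)%:E - P (future N n @^-1` C))%E | C in seq_sigma].

Definition beta_coef (N : int -> Omega -> nat) (n : nat)
  (Q : Omega -> set (nat -> nat) -> R) : \bar R :=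
  (\int[P]_w beta_sup N n Q w)%E.

Definition strictly_stationary (N : int -> Omega -> nat) (lam : int -> Omega -> R) :=
  forall (h : int) (m : nat) (ts : 'I_m -> int) (ks : 'I_m -> nat)
         (Bs : 'I_m -> set R), (forall i, measurable (Bs i)) ->
    P (\bigcap_i (N (ts i + h) @^-1` [set ks i] `&` lam (ts i + h) @^-1` Bs i)) =
    P (\bigcap_i (N (ts i) @^-1` [set ks i] `&` lam (ts i) @^-1` Bs i)).

Definition ergodic (N : int -> Omega -> nat) (lam : int -> Omega -> R) :=
  forall C : set (int -> nat * R), path_sigma C ->
    C = [set x | C (fun t => x (t + 1))] ->
    let A := (fun w => fun t => (N t w, lam t w)) @^-1` C in
    P A = 0%E \/ P A = 1%E.

End Defs2.

(* Main.v *)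
(* For an intensity [l], let [count_law f l] be the law of the counts
   (N_1, N_2, ...) when lambda_1 = l.  No coupling of two copies of the process is
   needed: Poisson (l + m) is the convolution of Poisson l and
   Poisson m, so the Poisson means of [0, 1]-valued (resp. kappa2-Lipschitz)
   functions are 1-Lipschitz (resp. kappa2-Lipschitz) in the parameter.  Hence
   the probability of any event of (N_1, N_2, ...) is 1/(1 - kappa1)-Lipschitz
   in [l]: this constant L solves L = 1 + kappa1 L, so it survives one more time
   step, whatever the dimension of the event.  Each step of delay multiplies
   the constant by kappa1 + kappa2.  The conditional law of the future given the
   past counts is [count_law f] at lambda_1, which is a limit of backward
   iterations of [f], and averaging |l - l'| over the stationary law bounds the
   beta-mixing coefficients.  Ergodicity follows since an invariant event, which
   is determined by the counts, is asymptotically independent of itself.  The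
   second moment comes from a geometric drift of lambda^2. *)
Require Import Defs.
From HB Require Import structures.
From mathcomp Require Import all_boot all_order all_algebra.
From mathcomp Require Import all_classical all_reals all_analysis measurable_realfun.
From mathcomp Require Import ring lra zify.
Import Order.TTheory GRing.Theory Num.Theory.
Import numFieldNormedType.Exports.
Local Open Scope classical_set_scope.
Local Open Scope ring_scope.

Set Implicit Arguments.
Unset Strict Implicit.
Unset Printing Implicit Defensive.

(** * Poisson means *)

(** The difficulty is to compare the laws of an entire future for two intensities that need not ever
    become equal. While the counts agree, the gap between the intensities is multiplied by at most
    [kappa1] at each step, so the successive costs form a geometric series: this is the source of
    1/(1 - kappa1). The factor 2 in (i) comes from |l - l'| <= l + l', integrated in both variables
    against the law of lambda_1, and the exponent n - 1 counts the steps from time 1 to time n.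
    Measurability in the intensity is drawn from the Lipschitz bounds themselves. Since beta(n)
    conditions on counts alone, lambda_1 must be recovered from the counts before (i). That recovery
    uses E lambda_1 < oo, so (iv) comes before the other claims. As (i) speaks of every version of
    the conditional law, versions are compared on the countably many finite words of counts. *)

Section poisson.
Context {R : realType}.
Implicit Types (l m a b : R) (psi : nat -> \bar R).
Local Notation pois := (@Poisson_pmf_at R).

Lemma Poisson_pmf_ge0 l k : 0 <= l -> 0 <= pois l k.
Proof.
by move=> l0; rewrite /Poisson_pmf_at !mulr_ge0 ?expR_ge0 ?exprn_ge0// invr_ge0.
Qed.

Lemma Poisson_pmfS l k : k.+1%:R * pois l k.+1 = l * pois l k.
Proof.
rewrite /Poisson_pmf_at factS natrM exprS invfM.
have : (k.+1%:R : R) != 0 by rewrite pnatr_eq0.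
by move=> h; field; rewrite nat1r h pnatr_eq0 -lt0n fact_gt0.
Qed.

Lemma Poisson_pmfD l m n :
  pois (l + m) n = \sum_(j < n.+1) pois l j * pois m (n - j)%N.
Proof.
rewrite /Poisson_pmf_at addrC exprDn mulr_sumr mulr_suml; apply: eq_bigr => i _.
have in' : (i <= n)%N by rewrite -ltnS.
rewrite opprD expRD -(bin_fact in') !natrM -mulr_natr.
have h1 : ('C(n, i)%:R : R) != 0 by rewrite pnatr_eq0 -lt0n bin_gt0.
have h2 : ((i`!)%:R : R) != 0 by rewrite pnatr_eq0 -lt0n fact_gt0.
have h3 : (((n - i)`!)%:R : R) != 0 by rewrite pnatr_eq0 -lt0n fact_gt0.
by field; rewrite h1 h2 h3.
Qed.

Local Open Scope ereal_scope.

Definition poisson_mean l psi := \sum_(k <oo) (pois l k)%:E * psi k.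

Lemma poisson_mean_ge0 l psi : (0 <= l)%R -> (forall k, 0 <= psi k) ->
  0 <= poisson_mean l psi.
Proof.
move=> l0 p0; apply: nneseries_ge0 => k _ _.
by rewrite mule_ge0// lee_fin Poisson_pmf_ge0.
Qed.

Lemma le_poisson_mean l psi psi' : (0 <= l)%R -> (forall k, 0 <= psi k) ->
  (forall k, psi k <= psi' k) -> poisson_mean l psi <= poisson_mean l psi'.
Proof.
move=> l0 p0 h; apply: lee_nneseries => k *.
  by rewrite mule_ge0// lee_fin Poisson_pmf_ge0.
by apply: lee_wpmul2l => //; rewrite lee_fin Poisson_pmf_ge0.
Qed.

Lemma poisson_meanDr l psi psi' : (0 <= l)%R -> (forall k, 0 <= psi k) ->
  (forall k, 0 <= psi' k) ->
  poisson_mean l (fun k => psi k + psi' k) =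
  poisson_mean l psi + poisson_mean l psi'.
Proof.
move=> l0 p0 p0'; rewrite /poisson_mean -nneseriesD; last 2 first.
- by move=> k _ _; rewrite mule_ge0// lee_fin Poisson_pmf_ge0.
- by move=> k _ _; rewrite mule_ge0// lee_fin Poisson_pmf_ge0.
by apply: eq_eseriesr => k _; rewrite ge0_muleDr.
Qed.

Lemma poisson_meanZ l a psi : (0 <= l)%R -> (forall k, 0 <= psi k) ->
  poisson_mean l (fun k => a%:E * psi k) = a%:E * poisson_mean l psi.
Proof.
move=> l0 p0; rewrite /poisson_mean -nneseriesZl.
  by apply: eq_eseriesr => k _; rewrite muleCA.
by move=> k _; rewrite mule_ge0// lee_fin Poisson_pmf_ge0.
Qed.

Lemma poisson_mean1 l : (0 <= l)%R -> poisson_mean l (fun=> 1) = 1.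
Proof.
move=> l0.
have e0 k : 0 <= (exp_coeff l k)%:E by rewrite lee_fin exp_coeff_ge0.
transitivity ((expR (- l))%:E * \sum_(k <oo) (exp_coeff l k)%:E).
  rewrite -nneseriesZl//; apply: eq_eseriesr => k _.
  by rewrite mule1 -EFinM /Poisson_pmf_at mulrA.
suff -> : \sum_(k <oo) (exp_coeff l k)%:E = (expR l)%:E.
  by rewrite -EFinM mulrC expRxMexpNx_1.
apply/cvg_lim => //.
have := is_cvg_series_exp_coeff l.
rewrite -/(expR l) => /cvg_ex[/= x hx].
have -> : expR l = x by apply/cvg_lim.
under eq_fun do rewrite sumEFin.
exact: cvg_EFin (nearW _ _) hx.
Qed.

Lemma poisson_mean_cst l (x : \bar R) : (0 <= l)%R -> 0 <= x ->
  poisson_mean l (fun=> x) = x.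
Proof.
move=> l0; case: x => [r r0|_|//].
  rewrite -[RHS]mule1 -(poisson_mean1 l0) -poisson_meanZ//.
  by congr poisson_mean; apply/funext => k; rewrite mule1.
rewrite /poisson_mean; apply: (@nneseries_pinfty _ _ _ 0%N) => //.
  by move=> n _; rewrite mule_ge0// lee_fin Poisson_pmf_ge0.
rewrite gt0_muley// lte_fin /Poisson_pmf_at expr0 mulr1 fact0 divr1.
exact: expR_gt0.
Qed.

(** The Stein-Chen identity, a summation of [Poisson_pmfS]. It yields the first two moments
    below. *)
Lemma poisson_mean_natr l psi : (0 <= l)%R -> (forall k, 0 <= psi k) ->
  poisson_mean l (fun k => k%:R%:E * psi k) =
  l%:E * poisson_mean l (fun k => psi k.+1).
Proof.
move=> l0 p0; rewrite /poisson_mean nneseries_recl//; last first.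
  move=> k _; rewrite mule_ge0// ?lee_fin ?Poisson_pmf_ge0//.
  by rewrite mule_ge0// lee_fin.
rewrite mul0e mule0 add0e -nneseriesZl; last first.
  by move=> k _; rewrite mule_ge0// lee_fin Poisson_pmf_ge0.
rewrite -nneseries_addn; last first.
  move=> k; rewrite mule_ge0// ?lee_fin ?Poisson_pmf_ge0//.
  by rewrite mule_ge0// lee_fin.
apply: eq_eseriesr => k _; rewrite addn1 muleA -EFinM muleA -EFinM.
by rewrite [X in X%:E * _]mulrC Poisson_pmfS.
Qed.

Lemma poisson_mean_id l : (0 <= l)%R -> poisson_mean l (fun k => k%:R%:E) = l%:E.
Proof.
move=> l0; transitivity (poisson_mean l (fun k => k%:R%:E * 1)).
  by congr poisson_mean; apply/funext => k; rewrite mule1.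
by rewrite poisson_mean_natr// poisson_mean1// mule1.
Qed.

Lemma poisson_mean_sqr l : (0 <= l)%R ->
  poisson_mean l (fun k => (k%:R ^+ 2)%:E) = (l ^+ 2 + l)%:E.
Proof.
move=> l0; transitivity (poisson_mean l (fun k => k%:R%:E * k%:R%:E)).
  by congr poisson_mean; apply/funext => k; rewrite -EFinM expr2.
rewrite poisson_mean_natr//.
under [in X in poisson_mean _ X]eq_fun do rewrite -addn1 natrD EFinD.
rewrite poisson_meanDr// poisson_mean_id// poisson_mean1//.
by rewrite -EFinD -EFinM mulrDr mulr1 expr2.
Qed.

(** Convolution as a Cauchy product: the triangular array [F n j], set to 0 for j > n, is summed by
    rows and then by columns, which nonnegativity allows. *)
Lemma poisson_meanD l m psi : (0 <= l)%R -> (0 <= m)%R -> (forall k, 0 <= psi k) ->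
  poisson_mean (l + m) psi =
  poisson_mean l (fun j => poisson_mean m (fun i => psi (j + i)%N)).
Proof.
move=> l0 m0 p0.
pose F n j := if (j <= n)%N then (pois l j * pois m (n - j))%:E * psi n else 0.
have F0 n j : 0 <= F n j.
  rewrite /F; case: ifPn => // _; rewrite mule_ge0// lee_fin mulr_ge0//.
    exact: Poisson_pmf_ge0.
  exact: Poisson_pmf_ge0.
transitivity (\sum_(n <oo) \sum_(j <oo) F n j).
  apply: eq_eseriesr => n _.
  rewrite (@nneseries_split _ _ 0 n.+1)//.
  rewrite [X in _ + X]eseries0 ?adde0; last first.
    by move=> i ni _; rewrite /F leqNgt ni.
  rewrite Poisson_pmfD -sumEFin ge0_sume_distrl; last first.
    by move=> i _; rewrite lee_fin mulr_ge0// Poisson_pmf_ge0.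
  rewrite add0n big_mkord; apply: eq_bigr => i _.
  by rewrite /F -ltnS ltn_ord.
rewrite nneseries_interchange//; apply: eq_eseriesr => j _.
rewrite (@nneseries_split _ _ 0 j)// big1_seq ?add0e; last first.
  move=> i /=; rewrite mem_index_iota add0n => /andP[_ ij].
  by rewrite /F leqNgt ij.
rewrite -nneseries_addn// -nneseriesZl; last first.
  by move=> i _; rewrite mule_ge0// lee_fin Poisson_pmf_ge0.
apply: eq_eseriesr => i _.
by rewrite /F leq_addl addnK EFinM muleA addnC.
Qed.

Lemma poisson_mean_affine l a b : (0 <= l)%R -> (0 <= a)%R -> (0 <= b)%R ->
  poisson_mean l (fun i => (a * i%:R + b)%:E) = (a * l + b)%:E.
Proof.
move=> l0 a0 b0; under [in X in poisson_mean _ X]eq_fun do rewrite EFinD EFinM.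
rewrite poisson_meanDr ?poisson_meanZ ?poisson_mean_id ?poisson_mean_cst//.
- by move=> k; rewrite -EFinM lee_fin mulr_ge0.
Qed.

(* Under Poisson (l + m) the count is [j + i], with [j] of law Poisson l and an
   independent excess [i] of mean [m]. *)
Lemma poisson_mean_le_shift l m a b psi psi' :
  (0 <= l)%R -> (0 <= m)%R -> (0 <= a)%R -> (0 <= b)%R ->
  (forall k, 0 <= psi k) -> (forall k, 0 <= psi' k) ->
  (forall j i, psi' (j + i)%N <= psi j + (a * i%:R + b)%:E) ->
  poisson_mean (l + m) psi' <= poisson_mean l psi + (a * m + b)%:E.
Proof.
move=> l0 m0 a0 b0 p0 p0' h; rewrite poisson_meanD//.
have amb0 : 0 <= (a * m + b)%:E by rewrite lee_fin addr_ge0 ?mulr_ge0.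
rewrite -[X in _ + X](poisson_mean_cst l0)// -poisson_meanDr//.
apply: le_poisson_mean => // j; first exact: poisson_mean_ge0.
rewrite -poisson_mean_affine// -(@poisson_mean_cst m (psi j))//.
rewrite -poisson_meanDr//; last by move=> k; rewrite lee_fin addr_ge0// mulr_ge0.
exact: le_poisson_mean.
Qed.

Lemma poisson_mean_shift_le l m a b psi psi' :
  (0 <= l)%R -> (0 <= m)%R -> (0 <= a)%R -> (0 <= b)%R ->
  (forall k, 0 <= psi k) -> (forall k, 0 <= psi' k) ->
  (forall j i, psi j <= psi' (j + i)%N + (a * i%:R + b)%:E) ->
  poisson_mean l psi <= poisson_mean (l + m) psi' + (a * m + b)%:E.
Proof.
move=> l0 m0 a0 b0 p0 p0' h; rewrite poisson_meanD//.
have amb0 : 0 <= (a * m + b)%:E by rewrite lee_fin addr_ge0 ?mulr_ge0.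
rewrite -[X in _ + X](poisson_mean_cst l0)// -poisson_meanDr//; last first.
  by move=> k; exact: poisson_mean_ge0.
apply: le_poisson_mean => // j.
rewrite -poisson_mean_affine// -poisson_meanDr//; last first.
  by move=> k; rewrite lee_fin addr_ge0// mulr_ge0.
rewrite -[leLHS](poisson_mean_cst m0)//.
exact: le_poisson_mean.
Qed.

End poisson.

(** * The law of the counts started from a given intensity *)

(** The generator of [seq_sigma], named so that sequences form a measurable type whose measurable
    sets are [seq_sigma] by conversion. *)
Definition seq_gen : set (set (nat -> nat)) :=
  [set A | exists (i k : nat), A = [set x | x i = k]].

Notation seqT := (g_sigma_algebraType seq_gen).

Definition scons (k : nat) (x : nat -> nat) (i : nat) : nat :=
  if i is j.+1 then x j else k.

Definition word (w : seq nat) : set (nat -> nat) :=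
  [set x | forall i, (i < size w)%N -> x i = nth 0%N w i].

Definition words : set (set (nat -> nat)) :=
  [set A | A = set0 \/ exists w, A = word w].

Lemma measurable_coord i k : measurable ([set x | x i = k] : set seqT).
Proof. by apply: sub_gen_smallest; exists i, k. Qed.

Lemma measurable_fun_seqT d (T : measurableType d) (g : T -> seqT) :
  (forall i k, measurable [set x | g x i = k]) -> measurable_fun setT g.
Proof.
move=> h; apply: (measurability (seq_gen : set (set seqT))) => //.
by move=> _ [_ [i [k ->]] <-]; rewrite setTI; exact: h.
Qed.

Lemma measurable_scons k : measurable_fun setT (scons k : seqT -> seqT).
Proof.
apply: measurable_fun_seqT => -[|i] m /=; last exact: measurable_coord.
have [->|km] := eqVneq k m.
  by rewrite (_ : [set _ | _] = setT)//; apply/seteqP.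
rewrite (_ : [set _ | _] = set0)//; apply/seteqP; split => //= x /eqP.
by rewrite (negbTE km).
Qed.

Lemma measurable_seq_shift n :
  measurable_fun setT ((fun x i => x (n + i)%N) : seqT -> seqT).
Proof. by apply: measurable_fun_seqT => i m; exact: measurable_coord. Qed.

Lemma measurable_word w : measurable (word w : set seqT).
Proof.
rewrite (_ : word w = \bigcap_(i in `I_(size w)) [set x | x i = nth 0%N w i])//.
by apply: fin_bigcap_measurable => // i _; exact: measurable_coord.
Qed.

(** Either the shorter word is a prefix of the longer one, whose cylinder is then the intersection,
    or they disagree somewhere and the intersection is empty; hence [set0] in [words]. *)
Lemma words_setI : setI_closed words.
Proof.
have aux w v : (size w <= size v)%N -> words (word w `&` word v).
  move=> wv; have [e|ne] := pselect (forall i, (i < size w)%N -> nth 0%N v i = nth 0%N w i).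
    right; exists v; apply/seteqP; split => [x []//|x xv]; split => // i iw.
    by rewrite xv ?e// (leq_trans iw).
  left; apply/seteqP; split => // x [xw xv]; apply: ne => i iw.
  by rewrite -xw// -xv// (leq_trans iw).
move=> A B [->|[w ->]]; first by rewrite set0I; left.
move=> [->|[v ->]]; first by rewrite setI0; left.
have [|/ltnW] := leqP (size w) (size v); first exact: aux.
by rewrite setIC; exact: aux.
Qed.

Lemma measurable_words : (measurable : set (set seqT)) = <<s words >>.
Proof.
apply/seteqP; split; last first.
  apply: smallest_sub; first exact: sigma_algebra_measurable.
  by move=> A [->|[w ->]]; [exact: measurable0|exact: measurable_word].
apply: smallest_sub; first exact: smallest_sigma_algebra.
move=> _ [i [k ->]].
pose F (w : seq nat) : set (nat -> nat) :=
  if (size w == i.+1) && (nth 0%N w i == k) then word w else set0.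
rewrite (_ : [set x | _] = \bigcup_w F w); last first.
  apply/seteqP; split => [x xik|x [w _]]; last first.
    rewrite /F; case: ifPn => // /andP[/eqP sw /eqP wi] xw.
    by rewrite /= xw ?sw.
  exists (mkseq x i.+1) => //; rewrite /F size_mkseq eqxx nth_mkseq// xik eqxx/=.
  by move=> j; rewrite size_mkseq => ji; rewrite nth_mkseq.
have mF w : (<<s words >>) (F w).
  rewrite /F; case: ifP => _; apply: sub_gen_smallest; last by left.
  by right; exists w.
pose U : measurableType _ := g_sigma_algebraType words.
exact: (@countable_bigcupT_measurable _ U (seq nat) F (countableP _) mF).
Qed.

Lemma seq_measure_unique (R : realType) (m1 m2 : {measure set seqT -> \bar R}) :
  (forall w, m1 (word w) = m2 (word w)) -> (m1 setT < +oo)%E ->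
  forall A, measurable A -> m1 A = m2 A.
Proof.
move=> h moo A mA.
have wnil : word [::] = setT by apply/seteqP.
apply: (@measure_unique _ R seqT (words : set (set seqT)) (fun=> word [::])
  measurable_words) => //.
- exact: words_setI.
- by move=> _; right; exists [::].
- by rewrite wnil; apply/seteqP; split => // x _; exists 0%N.
- by move=> B [->|[w ->]]; rewrite ?measure0.
- by rewrite wnil.
Qed.

Lemma scons_word k k' w :
  scons k @^-1` (word (k' :: w)) = if k == k' then word w else set0.
Proof.
apply/seteqP; split => [x xw|x].
  move: (xw 0%N isT) => /= ->; rewrite eqxx => i iw.
  exact: (xw i.+1).
case: ifP => // /eqP -> xw [|i]//= iw; exact: xw.
Qed.

(** * Coding of count paths by points of the unit interval *)

Section nested_intervals.
Context {R : realType}.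
Implicit Types (l u : R).
Local Notation pois := (@Poisson_pmf_at R).

(** The mass strictly below [k], so that the cell of [k] is [pcdf l k, pcdf l k.+1[. *)
Definition pcdf l k : R := \sum_(0 <= j < k) pois l j.

Lemma pcdfS l k : pcdf l k.+1 = pcdf l k + pois l k.
Proof. by rewrite /pcdf big_nat_recr. Qed.

Lemma pcdf_le l : 0 <= l -> {homo pcdf l : m n / (m <= n)%N >-> m <= n}.
Proof.
move=> l0; apply: homo_leq; first by [].
  exact: le_trans.
by move=> k; rewrite pcdfS lerDl Poisson_pmf_ge0.
Qed.

Lemma pcdf_ge0 l k : 0 <= l -> 0 <= pcdf l k.
Proof. by move=> l0; rewrite sumr_ge0// => *; exact: Poisson_pmf_ge0. Qed.

Lemma pcdf_le1 l k : 0 <= l -> pcdf l k <= 1.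
Proof.
move=> l0; rewrite -lee_fin -(poisson_mean1 l0) -sumEFin.
under eq_bigr do rewrite -[_%:E]mule1.
apply: nneseries_lim_ge => n _ _; rewrite mule1 lee_fin; exact: Poisson_pmf_ge0.
Qed.

Lemma pcdf_cell l u : 0 <= l -> 0 <= u < 1 ->
  exists k, pcdf l k <= u < pcdf l k.+1.
Proof.
move=> l0 /andP[u0 u1].
have : exists n, u < pcdf l n.
  apply: contrapT => /forallNP h; move: u1; rewrite ltNge => /negP; apply.
  rewrite -lee_fin -(poisson_mean1 l0); apply: lime_le.
    apply: is_cvg_nneseries => n _ _.
    by rewrite mule1 lee_fin Poisson_pmf_ge0.
  apply: nearW => n; under eq_bigr do rewrite mule1.
  by rewrite sumEFin lee_fin leNgt; apply/negP/h.
case/ex_minnP => -[|k]; first by rewrite /pcdf big_geq// ltNge u0.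
move=> uk kmin; exists k; rewrite uk andbT leNgt; apply/negP => /kmin.
by rewrite ltnn.
Qed.

Definition cell l u : nat := xget 0%N [set k | pcdf l k <= u < pcdf l k.+1].

Lemma cellP l u k : 0 <= l -> 0 <= u < 1 ->
  cell l u = k <-> pcdf l k <= u < pcdf l k.+1.
Proof.
move=> l0 u01; have := xgetPex 0%N (pcdf_cell l0 u01).
rewrite -/(cell l u) /= => /andP[a b]; split => [<-|/andP[c e]].
  by rewrite a b.
apply/eqP; rewrite eqn_leq; apply/andP; split; rewrite leqNgt; apply/negP => h.
  by have := le_lt_trans (le_trans (pcdf_le l0 h) a) e; rewrite ltxx.
by have := le_lt_trans (le_trans (pcdf_le l0 h) c) b; rewrite ltxx.
Qed.

Variable F : R -> nat -> R.
Hypothesis F0 : forall l k, 0 <= l -> 0 <= F l k.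

(* [itinerary l u] reads a point [u] of [0, 1[ as a path of counts: [u] selects a
   cell of the partition of [0, 1[ into intervals of lengths [pois l k], and its
   rescaled position inside the cell drives the next step.  [wlo] and [wlen] are
   the left end and the length of the interval of the [u] whose path starts
   with a given word. *)
Fixpoint itinerary l u (i : nat) : nat :=
  let k := cell l u in
  if i is j.+1 then itinerary (F l k) ((u - pcdf l k) / pois l k) j else k.

Fixpoint wlo l (w : seq nat) : R :=
  if w is k :: v then pcdf l k + pois l k * wlo (F l k) v else 0.

Fixpoint wlen l (w : seq nat) : R :=
  if w is k :: v then pois l k * wlen (F l k) v else 1.

Lemma wlo_wlen l w : 0 <= l -> [/\ 0 <= wlo l w, 0 <= wlen l w & wlo l w + wlen l w <= 1].
Proof.
elim: w l => [|k w ih] l l0 /=; first by rewrite lexx ler01 add0r lexx.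
have [a b c] := ih _ (F0 k l0).
have p0 := Poisson_pmf_ge0 k l0.
split; [by apply: addr_ge0; [exact: pcdf_ge0|exact: mulr_ge0]|exact: mulr_ge0|].
apply: le_trans (pcdf_le1 k.+1 l0); rewrite pcdfS -addrA lerD2l -mulrDr.
by rewrite ler_piMr.
Qed.

Lemma itinerary_word l u w : 0 <= l -> 0 <= u < 1 ->
  word w (itinerary l u) <-> wlo l w <= u < wlo l w + wlen l w.
Proof.
elim: w l u => [|k w ih] l u l0 u01.
  by rewrite /= add0r u01; split.
have p0 := Poisson_pmf_ge0 k l0.
have [a b c] := wlo_wlen w (F0 k l0).
have -> : word (k :: w) (itinerary l u) <->
    cell l u = k /\ word w (itinerary (F l k) ((u - pcdf l k) / pois l k)).
  split => [h|[h1 h2] [|i]//= iw].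
    have h0 := h 0%N isT; split => // i iw; have := h i.+1 iw => /=.
    by rewrite /= in h0; rewrite h0.
  by rewrite h1; exact: h2.
rewrite cellP// pcdfS /=.
(* This happens for l = 0 and k > 0. The rescaling would divide by zero, but the cell and the
   interval of the word are both empty. *)
have [p00|pn0] := eqVneq (pois l k) 0.
  rewrite p00 !mul0r !addr0; split.
    by case=> /andP[h1 h2] _; move: (le_lt_trans h1 h2); rewrite ltxx.
  by move=> /andP[h1 h2]; move: (le_lt_trans h1 h2); rewrite ltxx.
have pp : 0 < pois l k by rewrite lt_neqAle eq_sym pn0.
have eqs x : (x <= (u - pcdf l k) / pois l k) = (pcdf l k + pois l k * x <= u).
  by rewrite ler_pdivlMr// mulrC lerBrDl.
have eqs' x : ((u - pcdf l k) / pois l k < x) = (u < pcdf l k + pois l k * x).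
  by rewrite ltr_pdivrMr// mulrC ltrBlDl.
have u'01 : pcdf l k <= u < pcdf l k + pois l k ->
    0 <= (u - pcdf l k) / pois l k < 1.
  by rewrite eqs eqs' mulr0 mulr1 addr0.
split => [[h1]|].
  by move=> /(ih _ _ (F0 k l0) (u'01 h1)); rewrite eqs eqs' mulrDr addrA.
move=> /andP[h1 h2].
have h3 : pcdf l k <= u < pcdf l k + pois l k.
  apply/andP; split; first by apply: le_trans h1; rewrite lerDl mulr_ge0.
  by apply: (lt_le_trans h2); rewrite -addrA lerD2l -mulrDr ler_piMr.
split=> //; apply/(ih _ _ (F0 k l0) (u'01 h3)).
by rewrite eqs eqs' mulrDr addrA h1.
Qed.

End nested_intervals.

Section count_law.
Context {R : realType}.
Variable f : R -> nat -> R.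
Implicit Types (l u : R).
Local Notation pois := (@Poisson_pmf_at R).

(* [f] is arbitrary at negative intensities; with [fpos], [count_law f l] below is
   a probability measure without any hypothesis. *)
Definition fpos l k : R := Num.max 0 (f (Num.max 0 l) k).

Lemma fpos_ge0 l k : 0 <= l -> 0 <= fpos l k.
Proof. by move=> _; rewrite le_max lexx. Qed.

(** Points outside [0, 1[ are sent to 0 to make the map total; they carry no mass in
    [count_law_def]. *)
Definition count_path l u : seqT :=
  itinerary fpos (Num.max 0 l) (if 0 <= u < 1 then u else 0).

Lemma count_path_word l w : count_path l @^-1` word w =
  [set u | wlo fpos (Num.max 0 l) w <= (if 0 <= u < 1 then u else 0) <
           wlo fpos (Num.max 0 l) w + wlen fpos (Num.max 0 l) w].
Proof.
have l0 : 0 <= Num.max 0 l by rewrite le_max lexx.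
apply/seteqP; split => u /=.
  move/(itinerary_word fpos_ge0 w l0); apply; case: ifPn => //.
  by rewrite lexx ltr01.
move/(itinerary_word fpos_ge0 w l0); apply; case: ifPn => //.
by rewrite lexx ltr01.
Qed.

Lemma measurable_count_path l : measurable_fun setT (count_path l).
Proof.
apply: (measurability (words : set (set seqT))); first exact: measurable_words.
move=> _ [_ [->|[w ->]] <-]; rewrite setTI; first by rewrite preimage_set0.
rewrite count_path_word.
set a := wlo _ _ _; set b := a + _.
have mc : measurable_fun setT (fun u : R => if 0 <= u < 1 then u else 0).
  apply: measurable_fun_if => //.
  apply: measurable_and => //.
    exact: measurable_fun_ler.
  exact: measurable_fun_ltr.
rewrite (_ : [set u | _] =
  (fun u : R => if 0 <= u < 1 then u else 0) @^-1` `[a, b[%classic); last first.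
  by apply/seteqP; split => u /=; rewrite in_itv.
by rewrite -[X in measurable X]setTI; apply: mc.
Qed.

(** The image of the uniform law on [0, 1[ replaces an infinite composition of kernels: the interval
    of a word has the product of the Poisson weights as its length. *)
Definition count_law_def l : {measure set seqT -> \bar R}.
Proof.
refine (pushforward (mrestr (@lebesgue_measure R) (@measurable_itv R `[0, 1[))
  (count_path l) : {measure set seqT -> \bar R}).
exact: measurable_count_path.
Defined.

(* Locked so that simplification does not expose the underlying Lebesgue
   measure. *)
Definition count_law := locked count_law_def.

Lemma count_law_word l w :
  count_law l (word w) = (wlen fpos (Num.max 0 l) w)%:E.
Proof.
rewrite /count_law -lock /= /pushforward /mrestr count_path_word.
have l0 : 0 <= Num.max 0 l by rewrite le_max lexx.
have [a0 b0 ab1] := wlo_wlen fpos_ge0 w l0.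
set a := wlo _ _ _ in a0 ab1 *; set b := wlen _ _ _ in b0 ab1 *.
rewrite (_ : _ `&` _ = `[a, a + b[%classic); last first.
  apply/seteqP; split => u /=; rewrite !in_itv/=.
    by move=> [+ u01]; rewrite u01.
  move=> /andP[au uab]; have u01 : 0 <= u < 1.
    by rewrite (le_trans a0 au) (lt_le_trans uab).
  by rewrite u01 au uab.
rewrite lebesgue_measure_itv/= lte_fin; case: ifPn => [_|].
  by rewrite -EFinB addrAC subrr add0r.
by rewrite -leNgt gerDl => b0'; congr EFin; apply/eqP; rewrite eq_le b0.
Qed.

Lemma count_lawT l : count_law l setT = 1%E.
Proof.
rewrite (_ : setT = word [::]) ?count_law_word//.
by apply/seteqP.
Qed.

Hypothesis f0 : forall l y, 0 <= l -> 0 <= f l y.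

Local Open Scope ereal_scope.

(** Conditioning on the first count. Both sides are finite measures in [C], the right one being a
    Poisson mixture of images by [scons k]; on a word starting with [k] only the term [k] survives,
    so they agree on words. *)
Lemma count_law_rec l (C : set seqT) : (0 <= l)%R -> measurable C ->
  count_law l C =
  poisson_mean l (fun k => count_law (f l k) (scons k @^-1` C)).
Proof.
move=> l0 mC.
pose p k : {nonneg R} := NngNum (Poisson_pmf_ge0 k l0).
have [ps psE] : exists ps : nat -> {measure set seqT -> \bar R}, forall k A,
    ps k A = count_law (f l k) (scons k @^-1` A).
  have h k : exists m : {measure set seqT -> \bar R}, forall A,
      m A = count_law (f l k) (scons k @^-1` A).
    unshelve eexists (pushforward (count_law (f l k)) (scons k : seqT -> seqT)
      : {measure set seqT -> \bar R}); first exact: measurable_scons.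
    by [].
  by have [g gE] := choice h; exists g.
pose m2 : {measure set seqT -> \bar R} := mseries (fun k => mscale (p k) (ps k)) 0.
have m2E A : m2 A = poisson_mean l (fun k => count_law (f l k) (scons k @^-1` A)).
  by rewrite /m2 /= /mseries /poisson_mean; apply: eq_eseriesr => k _; rewrite -psE.
rewrite -m2E; apply: seq_measure_unique => //; last by rewrite count_lawT ltry.
case=> [|k w]; rewrite m2E.
  rewrite (_ : word [::] = setT); last by apply/seteqP.
  rewrite count_lawT -[LHS](poisson_mean1 l0); apply: eq_eseriesr => k _.
  by rewrite preimage_setT count_lawT.
rewrite /poisson_mean (@nneseriesD1 _ _ k)//; last first.
  by move=> j _; rewrite mule_ge0// lee_fin Poisson_pmf_ge0.
rewrite eseries0 ?adde0; last first.
  by move=> j _ jk; rewrite scons_word (negbTE jk) measure0 mule0.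
rewrite scons_word eqxx !count_law_word/= -EFinM.
have fl0 := f0 k l0.
by rewrite (max_r l0) {2}/fpos (max_r l0).
Qed.

End count_law.

(** * Lipschitz dependence on the initial intensity *)

Section lipschitz.
Context {R : realType}.
Variables (f : R -> nat -> R) (kappa1 kappa2 : R).
Hypothesis f0 : forall l y, 0 <= l -> 0 <= f l y.
Hypothesis kappa1_ge0 : 0 <= kappa1.
Hypothesis kappa2_ge0 : 0 <= kappa2.
Hypothesis kappa_lt1 : kappa1 + kappa2 < 1.
Hypothesis flip : forall l l' (y y' : nat), 0 <= l -> 0 <= l' ->
  `|f l y - f l' y'| <= kappa1 * `|l - l'| + kappa2 * `|y%:R - y'%:R|.

Local Open Scope ereal_scope.

(** One inequality suffices, as [x] and [y] can be exchanged; the sum form avoids subtracting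
    extended reals. *)
Definition lipschitz_nonneg (M : R) (phi : R -> \bar R) :=
  forall x y, (0 <= x)%R -> (0 <= y)%R -> phi x <= phi y + (M * `|x - y|)%:E.

(** The two comparison hypotheses serve the two orders of [x] and [y]: the count with the larger
    parameter is the other one plus an excess [i] of mean |x - y|. *)
Lemma poisson_mean_lipschitz (x y a b : R) psi psi' :
  (0 <= x)%R -> (0 <= y)%R -> (0 <= a)%R -> (0 <= b)%R ->
  (forall k, 0 <= psi k) -> (forall k, 0 <= psi' k) ->
  (forall j i, psi (j + i)%N <= psi' j + (a * i%:R + b)%:E) ->
  (forall j i, psi j <= psi' (j + i)%N + (a * i%:R + b)%:E) ->
  poisson_mean x psi <= poisson_mean y psi' + (a * `|x - y| + b)%:E.
Proof.
move=> x0 y0 a0 b0 p0 p0' h1 h2; have [xy|/ltW yx] := leP x y.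
  have -> : y = (x + (y - x))%R by lra.
  rewrite ler0_norm; last by lra.
  have -> : (- (x - (x + (y - x))) = y - x)%R by lra.
  by apply: poisson_mean_shift_le => //; lra.
have -> : x = (y + (x - y))%R by lra.
rewrite ger0_norm; last by lra.
have -> : (y + (x - y) - y = x - y)%R by lra.
by apply: poisson_mean_le_shift => //; lra.
Qed.

(* The 1 is the total variation distance of the Poisson laws, [kappa1 * L] comes
   from the next intensities when both counts agree. *)
Lemma lipschitz_step_bounded (L : R) (phi : nat -> R -> \bar R) : (0 <= L)%R ->
  (forall k x, 0 <= phi k x <= 1) -> (forall k, lipschitz_nonneg L (phi k)) ->
  lipschitz_nonneg (1 + kappa1 * L)
    (fun l => poisson_mean l (fun k => phi k (f l k))).
Proof.
move=> L0 phi01 lip x y x0 y0.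
have -> : ((1 + kappa1 * L) * `|x - y| = 1 * `|x - y| + L * (kappa1 * `|x - y|))%R
  by ring.
have b0 : (0 <= L * (kappa1 * `|x - y|))%R by rewrite !mulr_ge0.
have same j : phi j (f x j) <= phi j (f y j) + (L * (kappa1 * `|x - y|))%:E.
  apply: le_trans (lip j _ _ (f0 j x0) (f0 j y0)) _.
  rewrite leeD2l// lee_fin ler_wpM2l//.
  by apply: le_trans (flip _ _ x0 y0) _; rewrite subrr normr0 mulr0 addr0.
(* A positive excess already makes the allowance at least 1, which dominates any value of [phi]. *)
have far k z (p : \bar R) i : 0 <= p ->
    phi k z <= p + (1 * i.+1%:R + L * (kappa1 * `|x - y|))%:E.
  move=> p0; have /andP[_ le1] := phi01 k z.
  rewrite (le_trans le1)// -[leLHS]add0e leeD// lee_fin mul1r.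
  by rewrite -natr1 addrAC lerDr addr_ge0.
have phi0 k z : 0 <= phi k z by have /andP[] := phi01 k z.
apply: poisson_mean_lipschitz => // j [|i]; rewrite ?addn0 ?mulr0 ?add0r//.
- exact: far.
- exact: far.
Qed.

(** Each unit of excess count moves the next intensity by at most [kappa2], and the mean excess is
    |x - y|; the change of intensity itself contributes [kappa1]. *)
Lemma lipschitz_step (M : R) (phi : R -> \bar R) : (0 <= M)%R ->
  (forall x, 0 <= phi x) -> lipschitz_nonneg M phi ->
  lipschitz_nonneg ((kappa1 + kappa2) * M)
    (fun l => poisson_mean l (fun k => phi (f l k))).
Proof.
move=> M0 phi0 lip x y x0 y0.
have -> : ((kappa1 + kappa2) * M * `|x - y| =
  M * kappa2 * `|x - y| + M * kappa1 * `|x - y|)%R by ring.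
have key j i z : (`|j%:R - i%:R| = z%:R :> R)%R ->
    phi (f x j) <= phi (f y i) + (M * kappa2 * z%:R + M * kappa1 * `|x - y|)%:E.
  move=> jiz; apply: le_trans (lip _ _ (f0 j x0) (f0 i y0)) _.
  rewrite leeD2l// lee_fin.
  have := flip j i x0 y0; rewrite jiz => /(ler_wpM2l M0) /le_trans; apply.
  by rewrite le_eqVlt; apply/orP; left; apply/eqP; ring.
apply: poisson_mean_lipschitz => //; rewrite ?mulr_ge0// => j i; apply: key.
- by rewrite natrD addrAC subrr add0r normr_nat.
- by rewrite natrD opprD addrA subrr add0r normrN normr_nat.
Qed.

Definition findim (m : nat) (C : set (nat -> nat)) :=
  forall x y, (forall i, (i < m)%N -> x i = y i) -> C x -> C y.

Let L : R := (1 - kappa1)^-1.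
Let L0 : (0 <= L)%R. Proof.
rewrite /L invr_ge0 subr_ge0; apply/ltW/(le_lt_trans _ kappa_lt1).
by rewrite lerDl.
Qed.


Lemma count_law_ge0 l (C : set seqT) : 0 <= count_law f l C.
Proof. exact: measure_ge0. Qed.

Lemma count_law_le1 l (C : set seqT) : measurable C -> count_law f l C <= 1.
Proof.
by move=> mC; rewrite -(count_lawT f l); apply: le_measure; rewrite ?inE.
Qed.

Lemma measurable_scons_preimage k (C : set seqT) : measurable C ->
  measurable (scons k @^-1` C : set seqT).
Proof. by move=> mC; rewrite -[X in measurable X]setTI; exact: measurable_scons. Qed.

(** Fixing the first count lowers the dimension by one; in dimension 0 the event is empty or full
    and its probability is constant. *)
Lemma count_law_lipschitz_findim m (C : set seqT) : measurable C -> findim m C ->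
  lipschitz_nonneg L (count_law f ^~ C).
Proof.
elim: m C => [|m ih] C mC fC.
  move=> x y x0 y0; have -> : count_law f x C = count_law f y C.
    have [[z Cz]|nC] := pselect (exists z, C z).
      have -> : C = setT by apply/seteqP; split=> // z' _; apply: fC Cz.
      by rewrite !count_lawT.
    have -> : C = set0 by apply/seteqP; split=> // z Cz; apply: nC; exists z.
    by rewrite !measure0.
  by rewrite leeDl// lee_fin mulr_ge0.
have LE : L = (1 + kappa1 * L)%R.
  have h : (1 - kappa1 != 0)%R.
    rewrite lt0r_neq0// subr_gt0; apply: le_lt_trans kappa_lt1.
    by rewrite lerDl.
  by rewrite /L; field.
have mCk k := measurable_scons_preimage k mC.
have fCk k : findim m (scons k @^-1` C).
  by move=> x y xy; apply: fC => -[|i]//= im; exact: xy.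
move=> x y x0 y0; rewrite /= !(count_law_rec f0)// LE.
apply: (@lipschitz_step_bounded L (fun k l => count_law f l (scons k @^-1` C))) => //.
  by move=> k l; rewrite count_law_ge0 count_law_le1.
by move=> k; apply: ih.
Qed.

(* The constant does not depend on the dimension [m], so the bound passes to
   monotone limits of finite-dimensional events. *)
Lemma count_law_lipschitz (C : set seqT) : measurable C ->
  lipschitz_nonneg L (count_law f ^~ C).
Proof.
pose H := [set C : set seqT | measurable C /\ lipschitz_nonneg L (count_law f ^~ C)].
pose A := [set C : set seqT | measurable C /\ exists m, findim m C].
suff HT : measurable `<=` H by move=> /HT[].
have finU : setU_closed A.
  move=> B1 B2 [m1 [n1 f1]] [m2 [n2 f2]]; split; first exact: measurableU.
  exists (maxn n1 n2) => x y xy [B1x|B2x]; [left|right].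
    by apply: f1 B1x => i i1; apply: xy; rewrite leq_max i1.
  by apply: f2 B2x => i i1; apply: xy; rewrite leq_max i1 orbT.
have finD : setD_closed A.
  move=> B1 B2 [m1 [n1 f1]] [m2 [n2 f2]]; split; first exact: measurableD.
  exists (maxn n1 n2) => x y xy [B1x B2x]; split.
    by apply: f1 B1x => i i1; apply: xy; rewrite leq_max i1.
  apply: contra_not B2x; apply: f2 => i i1; apply/esym/xy.
  by rewrite leq_max i1 orbT.
have AT : A setT by split=> //; exists 0%N.
have rA : setring A by split => //; split => //; exists 0%N.
have lim (F : nat -> set seqT) G : measurable G -> (forall n, H (F n)) ->
    (forall l, count_law f l (F n) @[n --> \oo] --> count_law f l G) -> H G.
  move=> mG HF FG; split => // x y x0 y0 /=.
  have Gy : count_law f y (F n) + (L * `|x - y|)%:E @[n --> \oo] -->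
      count_law f y G + (L * `|x - y|)%:E.
    apply: cvgeD; [by rewrite fin_num_adde_defl|exact: FG|exact: cvg_cst].
  rewrite -(cvg_lim _ (FG x))// -(cvg_lim _ Gy)//.
  apply: lee_lim; [by apply/cvg_ex; eexists; exact: FG|
    by apply/cvg_ex; eexists; exact: Gy|].
  by apply: nearW => n; have [_ +] := HF n; exact.
have monH : monotone H.
  split=> F mF HF.
    have mU : measurable (\bigcup_i F i : set seqT).
      by apply: bigcupT_measurable => n; have [] := HF n.
    apply: (lim F) => // l; apply: nondecreasing_cvg_mu => // n.
    by have [] := HF n.
  have mI : measurable (\bigcap_i F i : set seqT).
    by apply: bigcapT_measurable => n; have [] := HF n.
  apply: (lim F) => // l; apply: nonincreasing_cvg_mu => //.
    by rewrite (le_lt_trans (count_law_le1 _ _)) ?ltry//; have [] := HF 0%N.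
  by move=> n; have [] := HF n.
have AH : A `<=` H.
  by move=> B [mB [m fB]]; split => //; exact: count_law_lipschitz_findim fB.
(* Monotone class theorem: [H] contains the sigma-ring generated by the ring [A], which is a
   sigma-algebra because [A] contains the whole space. *)
apply: subset_trans (monotone_setring_sub_g_sigma_ring monH rA AH).
have [sr0 srD srU] := smallest_sigma_ring A.
apply: smallest_sub; last first.
  move=> _ [i [k ->]]; apply: sub_gen_smallest; split; first exact: measurable_coord.
  by exists i.+1 => x y xy /= <-; rewrite xy.
split=> // B sB; apply: srD => //; exact: sub_gen_smallest.
Qed.

Definition seq_shift (n : nat) (x : nat -> nat) (i : nat) : nat := x (n + i)%N.

Lemma measurable_seq_shift_preimage n (C : set seqT) : measurable C ->
  measurable (seq_shift n @^-1` C : set seqT).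
Proof. by move=> mC; rewrite -[X in measurable X]setTI; exact: measurable_seq_shift. Qed.

Lemma count_law_shift_lipschitz n (C : set seqT) : measurable C ->
  lipschitz_nonneg ((kappa1 + kappa2) ^+ n / (1 - kappa1))
    (fun l => count_law f l (seq_shift n @^-1` C)).
Proof.
move=> mC; elim: n => [|n ih].
  by rewrite expr0 mul1r; exact: count_law_lipschitz.
move=> x y x0 y0; rewrite !(count_law_rec f0)//; try exact: measurable_seq_shift_preimage.
rewrite exprS -(mulrA (kappa1 + kappa2)%R).
have M0 : (0 <= (kappa1 + kappa2) ^+ n * L)%R.
  by rewrite mulr_ge0// exprn_ge0// addr_ge0.
(* A shift by n + 1 forgets the count put in front by [scons], so the preimages reduce by conversion
   to those of a shift by n. *)
exact: (lipschitz_step M0 (fun x => count_law_ge0 x _) ih x0 y0).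
Qed.

End lipschitz.

(** * Measure-theoretic lemmas *)

Section measure_lemmas.
Import HBNNSimple.
Context d (T : measurableType d) (R : realType) (mu : {measure set T -> \bar R}).
Local Open Scope ereal_scope.

(** From events to functions by monotone approximation with simple functions. It turns the Poisson
    hypothesis, stated for events, into one for integrals. *)
Lemma ge0_integral_density d' (Y : measurableType d') (A B : set T)
    (rho : T -> R) (phi : T -> Y) (h : Y -> \bar R) :
  measurable A -> measurable B -> measurable_fun setT rho ->
  (forall x, 0 <= rho x)%R -> measurable_fun setT phi ->
  (forall D, measurable D ->
    mu (A `&` phi @^-1` D) = \int[mu]_(x in B `&` phi @^-1` D) (rho x)%:E) ->
  measurable_fun setT h -> (forall y, 0 <= h y) ->
  \int[mu]_(x in A) h (phi x) = \int[mu]_(x in B) ((rho x)%:E * h (phi x)).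
Proof.
move=> mA mB mrho rho0 mphi H mh h0.
pose h_ := nnsfun_approx measurableT mh.
have mh_ n : measurable_fun setT (fun x => (h_ n (phi x))%:E).
  apply/measurable_EFinP; apply: measurableT_comp => //; exact: measurable_funP.
have h_nd x n m : (n <= m)%N -> (h_ n (phi x))%:E <= (h_ m (phi x))%:E.
  by move=> nm; rewrite lee_fin; exact/lefP/nd_nnsfun_approx.
have h_cvg x : (h_ n (phi x))%:E @[n --> \oo] --> h (phi x).
  by apply: cvg_nnsfun_approx => // y _; exact: h0.
transitivity (limn (fun n => \int[mu]_(x in A) (h_ n (phi x))%:E)).
  rewrite -monotone_convergence//.
  - by apply: eq_integral => x _; apply/esym/cvg_lim.
  - by move=> n; exact: measurable_funTS.
  - by move=> n x _; rewrite lee_fin.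
  - by move=> x _ n m; exact: h_nd.
transitivity (limn (fun n => \int[mu]_(x in B) ((rho x)%:E * (h_ n (phi x))%:E))); last first.
  rewrite -monotone_convergence//.
  - by apply: eq_integral => x _; apply/cvg_lim => //; apply: cvgeMl.
  - move=> n; apply: measurable_funTS; apply: emeasurable_funM => //.
    exact/measurable_EFinP.
  - by move=> n x _; rewrite mule_ge0// lee_fin.
  - by move=> x _ n m nm; apply: lee_wpmul2l; [rewrite lee_fin|exact: h_nd].
congr (limn _); apply/funext => n.
have mhr r : measurable (phi @^-1` (h_ n @^-1` [set r])).
  by rewrite -[X in measurable X]setTI; apply: mphi.
have mind r : measurable_fun setT (fun x => \1_(h_ n @^-1` [set r]) (phi x) : R).
  rewrite (_ : (fun _ => _) = \1_(phi @^-1` (h_ n @^-1` [set r])))//.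
have mrind r : measurable_fun setT
    (fun x => (r * \1_(h_ n @^-1` [set r]) (phi x))%:E : \bar R).
  by apply/measurable_EFinP; apply: measurable_funM.
transitivity (\sum_(r \in range (h_ n)) \int[mu]_(x in A)
    (r * \1_(h_ n @^-1` [set r]) (phi x))%:E).
  under eq_integral do rewrite fimfunE -fsumEFin//.
  rewrite ge0_integral_fsum//; last 2 first.
  - by move=> r; exact: measurable_funTS.
  - by move=> r x _; rewrite nnfun_muleindic_ge0.
transitivity (\int[mu]_(x in B) \sum_(r \in range (h_ n))
    ((rho x)%:E * (r * \1_(h_ n @^-1` [set r]) (phi x))%:E)); last first.
  apply: eq_integral => x _; rewrite [in RHS]fimfunE -fsumEFin//.
  rewrite ge0_mule_fsumr//.
  by move=> r; rewrite nnfun_muleindic_ge0.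
rewrite ge0_integral_fsum//; last 2 first.
- move=> r; apply: measurable_funTS; apply: emeasurable_funM => //.
  exact/measurable_EFinP.
- by move=> r x _; rewrite mule_ge0 ?lee_fin// -lee_fin nnfun_muleindic_ge0.
apply: eq_fsbigr => r /[!inE] -[y _ <-].
have r0 : (0 <= h_ n y)%R by [].
under eq_integral do rewrite EFinM.
under [RHS]eq_integral do rewrite EFinM muleCA.
have m1 : measurable_fun A (fun x => (\1_(h_ n @^-1` [set h_ n y]) (phi x))%:E : \bar R).
  by apply: measurable_funTS; exact/measurable_EFinP.
have m2 : measurable_fun B
    (fun x => (rho x)%:E * (\1_(h_ n @^-1` [set h_ n y]) (phi x))%:E).
  by apply: measurable_funTS; apply: emeasurable_funM; exact/measurable_EFinP.
rewrite ge0_integralZl_EFin// ge0_integralZl_EFin//; last first.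
  by move=> x _; rewrite mule_ge0 ?lee_fin.
congr (_ * _).
transitivity (mu (A `&` phi @^-1` (h_ n @^-1` [set h_ n y]))).
  rewrite setIC -integral_indic//.
rewrite H; last by rewrite -[X in measurable X]setTI; exact: measurable_funP.
rewrite integral_mkcondr; apply: eq_integral => x _.
rewrite /patch indicE (_ : (x \in _ @^-1` _) = (phi x \in h_ n @^-1` [set h_ n y]))//.
by case: (_ \in _); rewrite ?mule1 ?mule0.
Qed.

Lemma measurable_fun_nat_choice d' (Y : measurableType d') (F : nat -> T -> Y)
    (N : T -> nat) : (forall k, measurable_fun setT (F k)) ->
  (forall k, measurable (N @^-1` [set k])) ->
  measurable_fun setT (fun w => F (N w) w).
Proof.
move=> mF mN _ D mD; rewrite setTI.
rewrite (_ : _ @^-1` D = \bigcup_k (N @^-1` [set k] `&` (F k @^-1` D))).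
  apply: bigcupT_measurable => k; apply: measurableI => //.
  by rewrite -[X in measurable X]setTI; exact: mF.
by apply/seteqP; split => [w Dw|w [k _ [/= <-]]//]; exists (N w).
Qed.

End measure_lemmas.

Section mixture.
Context d d' (S : measurableType d) (T : measurableType d') (R : realType).
Variables (mu : {measure set S -> \bar R}) (B : set S).
Variable k : S -> {measure set T -> \bar R}.
Local Open Scope ereal_scope.

Definition mixture (C : set T) : \bar R := \int[mu]_(w in B) k w C.

Hypothesis mB : measurable B.
Hypothesis mk : forall C, measurable C -> measurable_fun setT (fun w => k w C).

Let mixture0 : mixture set0 = 0.
Proof. by rewrite /mixture integral0_eq// => w _; rewrite measure0. Qed.

Let mixture_ge0 C : 0 <= mixture C.
Proof. by apply: integral_ge0 => w _; exact: measure_ge0. Qed.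

Let mixture_sigma_additive : semi_sigma_additive mixture.
Proof.
move=> F mF tF mUF; rewrite [X in _ --> X](_ : _ =
    \sum_(i <oo) mixture (F i)).
  by apply: is_cvg_nneseries => n _ _; exact: mixture_ge0.
rewrite /mixture -integral_nneseries//; last first.
  by move=> n; apply: measurable_funTS; exact: mk.
by apply: eq_integral => w _; apply: measure_semi_bigcup.
Qed.

HB.instance Definition _ := isMeasure.Build _ _ _ mixture
  mixture0 mixture_ge0 mixture_sigma_additive.

End mixture.

(** Truncation at 0 is a contraction, so the extended function is continuous on the line. This is
    how kernels indexed by the intensity are shown to be measurable. *)
Lemma measurable_lipschitz_nonneg (R : realType) (M : R) (phi : R -> \bar R) :
  0 <= M -> (forall x, 0 <= x -> phi x \is a fin_num) ->
  lipschitz_nonneg M phi -> measurable_fun setT (fun x : R => phi (Num.max 0 x)).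
Proof.
move=> M0 fphi lip; pose g x := fine (phi (Num.max 0 x)).
have p0 (x : R) : 0 <= Num.max 0 x by rewrite le_max lexx.
have -> : (fun x => phi (Num.max 0 x)) = EFin \o g.
  by apply/funext => x; rewrite /g /= fineK// fphi.
apply/measurable_EFinP; apply: continuous_measurable_fun => x.
have gle y z : g y <= g z + M * `|y - z|.
  rewrite -lee_fin EFinD !fineK ?fphi//.
  apply: le_trans (lip _ _ (p0 y) (p0 z)) _; rewrite leeD2l// lee_fin ler_wpM2l//.
  have := ler_norm (y - z); have := ler_norm (z - y); rewrite distrC => h1 h2.
  by rewrite ler_norml /Num.max; do 2 case: ifPn; rewrite -?leNgt => *; lra.
apply/cvgrPdist_le => /= e e0.
near=> y.
have := gle x y; have := gle y x; rewrite (distrC y) => h1 h2.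
have h : M * `|x - y| <= e.
  (* M + 1 rather than M, to divide by a positive number. *)
  apply: (@le_trans _ _ ((M + 1) * `|x - y|)); first by rewrite ler_wpM2r// lerDl.
  rewrite mulrC -ler_pdivlMr; last by rewrite ltr_wpDl.
  by near: y; apply: cvgr_dist_le => //; rewrite divr_gt0// ltr_wpDl.
by rewrite ler_norml; lra.
Unshelve. all: end_near. Qed.

(** Squared mean plus variance, the Poisson variance being [l]. *)
Lemma poisson_mean_sqr_affine (R : realType) (l a b : R) :
  0 <= l -> 0 <= a -> 0 <= b ->
  poisson_mean l (fun k => ((a + b * k%:R) ^+ 2)%:E) =
  ((a + b * l) ^+ 2 + b ^+ 2 * l)%:E.
Proof.
move=> l0 a0 b0.
transitivity (poisson_mean l (fun k => (b ^+ 2)%:E * (k%:R ^+ 2)%:E +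
    ((2 * a * b) * k%:R + a ^+ 2)%:E)%E).
  congr poisson_mean; apply/funext => k; rewrite -EFinM -EFinD; congr EFin; ring.
rewrite poisson_meanDr//; last 2 first.
- by move=> k; rewrite -EFinM lee_fin mulr_ge0// sqr_ge0.
- by move=> k; rewrite lee_fin addr_ge0 ?sqr_ge0// !mulr_ge0.
rewrite poisson_meanZ//.
rewrite poisson_mean_sqr// poisson_mean_affine ?sqr_ge0//; last by rewrite !mulr_ge0.
by rewrite -EFinM -EFinD; congr EFin; ring.
Qed.

Lemma drift_bound (R : realType) (k a b : R) : 0 <= k < 1 -> 0 <= a -> 0 <= b ->
  exists rho D : R, [/\ 0 <= rho < 1, 0 <= D &
    forall l, 0 <= l -> (a + k * l) ^+ 2 + b ^+ 2 * l <= rho * l ^+ 2 + D].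
Proof.
move=> /andP[k0 k1] a0 b0.
have k21 : k ^+ 2 < 1 by rewrite expr_lt1.
have k20 : 0 <= k ^+ 2 by rewrite exprn_ge0.
(* Half of the gap between k^2 and 1 absorbs the linear term: c l <= e l^2 + c^2 / (4 e), by
   completing the square. *)
pose e := (1 - k ^+ 2) / 2; have e0 : 0 < e by rewrite /e; lra.
pose c := 2 * a * k + b ^+ 2.
exists (k ^+ 2 + e), (a ^+ 2 + c ^+ 2 / (4 * e)); split.
- by rewrite /e; lra.
- by rewrite addr_ge0 ?sqr_ge0// divr_ge0 ?sqr_ge0//; lra.
move=> l l0; rewrite -subr_ge0.
have -> : (k ^+ 2 + e) * l ^+ 2 + (a ^+ 2 + c ^+ 2 / (4 * e)) -
    ((a + k * l) ^+ 2 + b ^+ 2 * l) = (2 * e * l - c) ^+ 2 / (4 * e).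
  by rewrite /c; field; rewrite gt_eqF.
by rewrite divr_ge0 ?sqr_ge0//; lra.
Qed.

Lemma sigma_algebraI_gen (T : pointedType) (G : set (set T)) A B :
  <<s G >> A -> <<s G >> B -> <<s G >> (A `&` B).
Proof. exact: (@measurableI _ (g_sigma_algebraType G)). Qed.

Section lower_integral.
Import HBNNSimple.

(* [g] need not be measurable, which is needed for the supremum over an
   uncountable family of events in [beta_sup]. *)
Lemma ge0_le_integral_ae (d : measure_display) (T : measurableType d)
    (R : realType) (mu : {measure set T -> \bar R}) (g h : T -> \bar R) :
  (forall x, 0 <= g x)%E -> (forall x, 0 <= h x)%E -> measurable_fun setT h ->
  {ae mu, forall x, (g x <= h x)%E} -> (\int[mu]_x g x <= \int[mu]_x h x)%E.
Proof.
move=> g0 h0 mh gh; rewrite [leLHS]ge0_integralTE//; apply: ge_ereal_sup.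
move=> _ [k kg <-]; rewrite -integralT_nnsfun.
apply: ae_ge0_le_integral => //.
- by move=> x _; rewrite lee_fin.
- by apply/measurable_EFinP; exact: measurable_funP.
- by apply: filterS gh => x gx _; exact: le_trans gx.
Qed.

End lower_integral.

(** A Dynkin class argument. Setwise limits do not in general pass to increasing unions; here the
    single finite measure [mu] makes the remainder of the union small uniformly in [h]. *)
Lemma cvg_dominated_measures (d : measure_display) (T : measurableType d)
    (R : realType) (G : set (set T)) (phi : nat -> {measure set T -> \bar R})
    (psi mu : {measure set T -> \bar R}) :
  measurable = <<s G >> -> setI_closed G -> G setT -> (mu setT < +oo)%E ->
  (forall h A, measurable A -> (phi h A <= mu A)%E) ->
  (forall A, measurable A -> (psi A <= mu A)%E) ->
  (forall A, G A -> fine (phi h A) @[h --> \oo] --> fine (psi A)) ->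
  forall A, measurable A -> fine (phi h A) @[h --> \oo] --> fine (psi A).
Proof.
move=> mG GI GT muT phimu psimu Gcvg.
have mufin A : measurable A -> mu A \is a fin_num.
  move=> mA; rewrite ge0_fin_numE//; apply: le_lt_trans muT.
  by apply: le_measure; rewrite ?inE.
have finle (m : {measure set T -> \bar R}) A :
    measurable A -> (m A <= mu A)%E -> m A \is a fin_num.
  move=> mA mle; rewrite ge0_fin_numE//; apply: (le_lt_trans mle).
  by rewrite -ge0_fin_numE// mufin.
have phifin h A : measurable A -> phi h A \is a fin_num.
  by move=> mA; apply: finle => //; exact: phimu.
have psifin A : measurable A -> psi A \is a fin_num.
  by move=> mA; apply: finle => //; exact: psimu.
have split (m : {measure set T -> \bar R}) A B : measurable A -> measurable B ->
    A `<=` B -> (forall C, measurable C -> m C \is a fin_num) ->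
    fine (m B) = fine (m A) + fine (m (B `\` A)).
  move=> mA mB AB mfin; have mBA := measurableD mB mA.
  rewrite -fineD ?mfin// -measureU//; last by rewrite setDE setICA setICr setI0.
  by rewrite setDUK.
pose H := [set A | measurable A /\ fine (phi h A) @[h --> \oo] --> fine (psi A)].
suff HT : measurable `<=` H by move=> A /HT[].
rewrite mG; apply: (@lambda_system_subset T G GI setT) => //; last first.
  move=> A GA; split; last exact: Gcvg.
  by rewrite mG; exact: sub_gen_smallest.
split => //.
- by split; [exact: measurableT|exact: Gcvg].
- move=> B A AB [mB cB] [mA cA]; split; first exact: measurableD.
  have E (m : {measure set T -> \bar R}) : (forall C, measurable C -> m C \is a fin_num) ->
      fine (m (B `\` A)) = fine (m B) - fine (m A).
    by move=> mfin; rewrite (split m A B)// addrAC subrr add0r.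
  rewrite (E psi psifin); under eq_fun do rewrite (E _ (phifin _)).
  exact: cvgB.
- move=> F ndF HF.
  have mF n : measurable (F n) by have [] := HF n.
  have mU : measurable (\bigcup_n F n) by exact: bigcupT_measurable.
  split => //; apply/cvgrPdist_le => e e0.
  have mD n : measurable (\bigcup_n F n `\` F n) by exact: measurableD.
  have [n nP] : exists n, fine (mu (\bigcup_n F n `\` F n)) <= e / 2.
    have : (mu \o (fun n => \bigcup_n F n `\` F n)) n @[n --> \oo] --> (0 : \bar R).
      have <- : mu (\bigcap_n (\bigcup_n F n `\` F n)) = 0%E.
        rewrite (_ : \bigcap_n _ = set0) ?measure0//; apply/seteqP; split => // x h.
        by have [[n _ Fnx] _] := h 0%N I; have [_] := h n I.
      apply: nonincreasing_cvg_mu => //.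
      - by rewrite -ge0_fin_numE// mufin.
      - exact: bigcapT_measurable.
      - by move=> n m nm; apply/subsetPset; apply: setDS; exact/subsetPset/ndF.
    move=> /fine_cvgP[_ /cvgrPdist_le/(_ (e / 2))]; rewrite divr_gt0// => /(_ isT).
    move=> [n _ nP]; exists n; have := nP n (leqnn _).
    by rewrite sub0r normrN /= => /(le_trans (ler_norm _)).
  have [_ /cvgrPdist_le/(_ (e / 2))] := HF n; rewrite divr_gt0// => /(_ isT).
  apply: filterS => h hP.
  have sub : F n `<=` \bigcup_n F n by move=> x Fx; exists n.
  rewrite (split psi (F n) _ _ _ _ psifin)// (split (phi h) (F n) _ _ _ _ (phifin h))//.
  have b1 : fine (psi (\bigcup_n F n `\` F n)) <= e / 2.
    by apply: le_trans nP; apply: fine_le; rewrite ?psifin ?mufin ?psimu.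
  have b2 : fine (phi h (\bigcup_n F n `\` F n)) <= e / 2.
    by apply: le_trans nP; apply: fine_le; rewrite ?phifin ?mufin ?phimu.
  have c1 : 0 <= fine (psi (\bigcup_n F n `\` F n)) by exact: fine_ge0.
  have c2 : 0 <= fine (phi h (\bigcup_n F n `\` F n)) by exact: fine_ge0.
  move: hP b1 b2 c1 c2; rewrite !ler_norml => /andP[] *.
  by apply/andP; split; lra.
Qed.

(** * Two-sided count paths and their cylinders *)

Definition int_gen : set (set (int -> nat)) :=
  [set A | exists (t : int) (k : nat), A = [set x | x t = k]].

Notation intT := (g_sigma_algebraType int_gen).

(** A list of constraints (time, count), with repetitions and contradictions allowed, so that
    intersection is concatenation. *)
Definition cyl (s : seq (int * nat)) : set (int -> nat) :=
  [set x | forall p, p \in s -> x p.1 = p.2].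

Definition cyls : set (set (int -> nat)) := [set A | exists s, A = cyl s].

Lemma measurable_int_coord t k : measurable ([set x | x t = k] : set intT).
Proof. by apply: sub_gen_smallest; exists t, k. Qed.

Lemma measurable_fun_intT d (T : measurableType d) (g : T -> intT) :
  (forall i k, measurable [set x | g x i = k]) -> measurable_fun setT g.
Proof.
move=> h; apply: (measurability (int_gen : set (set intT))) => //.
by move=> _ [_ [i [k ->]] <-]; rewrite setTI; exact: h.
Qed.

Lemma cyl_cat s s' : cyl (s ++ s') = cyl s `&` cyl s'.
Proof.
apply/seteqP; split=> [x h|x [h h'] p].
  by split=> p ps; apply: h; rewrite mem_cat ps ?orbT.
by rewrite mem_cat => /orP[/h|/h'].
Qed.

Lemma cyl_cons p s : cyl (p :: s) = [set x | x p.1 = p.2] `&` cyl s.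
Proof.
rewrite -cat1s cyl_cat; congr (_ `&` _); apply/seteqP; split=> x h.
  by apply: h; rewrite inE.
by move=> q; rewrite inE => /eqP ->.
Qed.

Lemma cyl_nil : cyl [::] = setT.
Proof. by apply/seteqP. Qed.

Lemma cyls_setI : setI_closed cyls.
Proof. by move=> _ _ [s ->] [s' ->]; exists (s ++ s'); rewrite cyl_cat. Qed.

Lemma measurable_cyl s : measurable (cyl s : set intT).
Proof.
elim: s => [|p s ih]; first by rewrite cyl_nil; exact: (@measurableT _ intT).
rewrite cyl_cons; apply: (@measurableI _ intT) => //; exact: measurable_int_coord.
Qed.

Lemma measurable_cyls : (measurable : set (set intT)) = <<s cyls >>.
Proof.
apply/seteqP; split; last first.
  apply: smallest_sub; first exact: sigma_algebra_measurable.
  by move=> A [s ->]; exact: measurable_cyl.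
apply: smallest_sub; first exact: smallest_sigma_algebra.
move=> _ [t [k ->]]; apply: sub_gen_smallest; exists [:: (t, k)].
by rewrite cyl_cons cyl_nil setIT.
Qed.

(** * The stationary process *)

Section process.
Context d (Omega : measurableType d) (R : realType) (P : probability Omega R).
Variables (f : R -> nat -> R) (kappa1 kappa2 : R).
Variables (N : int -> Omega -> nat) (lam : int -> Omega -> R).
Hypothesis f0 : forall l y, 0 <= l -> 0 <= f l y.
Hypothesis kappa1_ge0 : 0 <= kappa1.
Hypothesis kappa2_ge0 : 0 <= kappa2.
Hypothesis kappa_lt1 : kappa1 + kappa2 < 1.
Hypothesis flip : forall l l' (y y' : nat), 0 <= l -> 0 <= l' ->
  `|f l y - f l' y'| <= kappa1 * `|l - l'| + kappa2 * `|y%:R - y'%:R|.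
Hypothesis mN : forall t k, measurable (N t @^-1` [set k]).
Hypothesis mlam : forall t, measurable_fun setT (lam t).
Hypothesis lam0 : forall t w, 0 <= lam t w.
Hypothesis stat : strictly_stationary P N lam.
Hypothesis lamE : forall t w, lam t w = f (lam (t - 1) w) (N (t - 1) w).
Hypothesis poissonN : forall t (k : nat) B,
  gen_sigma N lam [set s | s <= t - 1] [set s | s <= t] B ->
  P (B `&` N t @^-1` [set k]) =
    (\int[P]_(w in B) (Poisson_pmf_at (lam t w) k)%:E)%E.

Local Notation pois := (@Poisson_pmf_at R).
Local Notation past t :=
  (gen_sigma N lam [set s | s <= (t : int) - 1] [set s | s <= (t : int)]).

Lemma past_N t s k : s <= t - 1 -> past t (N s @^-1` [set k]).
Proof. by move=> st; apply: sub_gen_smallest; left; exists s, k. Qed.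

Lemma past_lam t s D : s <= t -> measurable D -> past t (lam s @^-1` D).
Proof. by move=> st mD; apply: sub_gen_smallest; right; exists s, D. Qed.

Lemma past_measurable t : past t `<=` measurable.
Proof.
apply: smallest_sub; first exact: sigma_algebra_measurable.
move=> A [[s [k [_ ->]]]//|[s [D [_ [mD ->]]]]].
by rewrite -[X in measurable X]setTI; exact: mlam.
Qed.

Lemma past_homo s t : s <= t -> past s `<=` past t.
Proof.
move=> st; apply: smallest_sub; first exact: smallest_sigma_algebra.
move=> A [[r [k [/= rs ->]]]|[r [D [/= rs [mD ->]]]]].
  by apply: past_N; lia.
by apply: past_lam => //; lia.
Qed.

Lemma past_step t B k : past t B -> past (t + 1) (B `&` N t @^-1` [set k]).
Proof.
move=> pB; apply: sigma_algebraI_gen; last by apply: past_N; lia.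
by apply: past_homo pB; lia.
Qed.

Lemma measurable_Poisson_pmf k : measurable_fun setT (fun l : R => pois l k).
Proof.
apply: measurable_funM => //; apply: measurable_funM; last exact: exprn_measurable.
by apply: measurableT_comp => //; exact: measurable_expR.
Qed.

Local Open Scope ereal_scope.

Lemma poissonN_integral t k B (h : R -> \bar R) : past t B ->
  measurable_fun setT h -> (forall l, 0 <= h l) ->
  \int[P]_(w in B `&` N t @^-1` [set k]) h (lam t w) =
  \int[P]_(w in B) ((pois (lam t w) k)%:E * h (lam t w)).
Proof.
move=> pB mh h0; have mB := past_measurable pB.
apply: ge0_integral_density => //; first exact: measurableI.
- exact: (measurableT_comp (measurable_Poisson_pmf k) (mlam t)).
- by move=> w; exact: Poisson_pmf_ge0.
- move=> D mD; rewrite setIAC; apply: poissonN.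
  by apply: sigma_algebraI_gen => //; exact: past_lam.
Qed.

(** The integral is cut along the values of [N t], and each piece is given by
    [poissonN_integral]. *)
Lemma poisson_markov t B (h : R -> nat -> \bar R) : past t B ->
  (forall k, measurable_fun setT (h ^~ k)) -> (forall l k, 0 <= h l k) ->
  \int[P]_(w in B) h (lam t w) (N t w) =
  \int[P]_(w in B) poisson_mean (lam t w) (h (lam t w)).
Proof.
move=> pB mh h0; have mB := past_measurable pB.
have mhk k : measurable_fun setT (fun w => h (lam t w) k).
  exact: (measurableT_comp (mh k) (mlam t)).
have BE : B = \bigcup_k (B `&` N t @^-1` [set k]).
  by apply/seteqP; split => [w Bw|w [k _ []]//]; exists (N t w).
have mk : measurable_fun setT (fun w => h (lam t w) (N t w)).
  exact: (@measurable_fun_nat_choice _ _ _ _ (fun k w => h (lam t w) k)).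
rewrite [in LHS]BE ge0_integral_bigcup//; last 3 first.
- by move=> k; exact: measurableI.
- exact: measurable_funTS.
- apply/trivIsetP => i j _ _ ij; apply/seteqP; split => // w [[_ /= wi] [_ /= wj]].
  by move: ij; rewrite -wi -wj eqxx.
rewrite /poisson_mean integral_nneseries//; last 2 first.
- move=> k; apply: measurable_funTS; apply: emeasurable_funM => //.
  apply/measurable_EFinP.
  exact: (measurableT_comp (measurable_Poisson_pmf k) (mlam t)).
- by move=> k w _; rewrite mule_ge0// lee_fin Poisson_pmf_ge0.
apply: eq_eseriesr => k _.
rewrite -(@poissonN_integral t k B (h ^~ k))//.
by apply: eq_integral => w; rewrite inE => -[_ /= ->].
Qed.

Lemma measurable_count_law (C : set seqT) : measurable C ->
  measurable_fun setT (fun x : R => count_law f (Num.max 0 x)%R C).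
Proof.
move=> mC; have lip := count_law_lipschitz f0 kappa1_ge0 kappa2_ge0 kappa_lt1 flip mC.
apply: measurable_lipschitz_nonneg lip; first by rewrite invr_ge0; move: kappa_lt1 kappa2_ge0; lra.
move=> x _; rewrite ge0_fin_numE//.
by rewrite (le_lt_trans (count_law_le1 _ _ _))// ltry.
Qed.

Lemma measurable_count_law_step j (C : set seqT) : measurable C ->
  measurable_fun setT (fun x : R => count_law f (f (Num.max 0 x)%R j) C).
Proof.
move=> mC; have lip := count_law_lipschitz f0 kappa1_ge0 kappa2_ge0 kappa_lt1 flip mC.
have L0 : (0 <= (1 - kappa1)^-1)%R.
  by rewrite invr_ge0; move: kappa_lt1 kappa2_ge0; lra.
apply: (@measurable_lipschitz_nonneg _ ((1 - kappa1)^-1 * kappa1)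
  (fun x => count_law f (f x j) C)) => [|x _|x y x0 y0]; first by rewrite mulr_ge0.
  by rewrite ge0_fin_numE// (le_lt_trans (count_law_le1 _ _ _))// ltry.
apply: le_trans (lip _ _ (f0 j x0) (f0 j y0)) _.
rewrite leeD2l// lee_fin -mulrA ler_wpM2l//.
by apply: le_trans (flip j j x0 y0) _; rewrite subrr normr0 mulr0 addr0.
Qed.

Lemma measurable_count_law_lam t (C : set seqT) : measurable C ->
  measurable_fun setT (fun w => count_law f (lam t w) C).
Proof.
move=> mC; rewrite (_ : (fun _ => _) = (fun x : R => count_law f (Num.max 0 x)%R C) \o lam t).
  exact: (measurableT_comp (measurable_count_law mC) (mlam t)).
by apply/funext => w /=; rewrite max_r.
Qed.

Definition tail (t : int) : Omega -> seqT := fun w i => N (t + i%:Z) w.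

Lemma measurable_tail t : measurable_fun setT (tail t).
Proof. by apply: measurable_fun_seqT => i k; exact: mN. Qed.

Lemma tail_scons t w : tail t w = scons (N t w) (tail (t + 1) w).
Proof.
apply/funext => -[|i]; rewrite /tail /=; first by rewrite addr0.
by congr (N _ w); lia.
Qed.

(** Induction on the word: the event that [N t] is its first letter joins [B] in the past of t + 1;
    averaging over [N t] with [poisson_markov] then restores the law at time t through
    [count_law_rec]. *)
Lemma tail_word t B v : past t B ->
  P (B `&` tail t @^-1` word v) = \int[P]_(w in B) count_law f (lam t w) (word v).
Proof.
elim: v t B => [|k v ih] t B pB; have mB := past_measurable pB.
  rewrite (_ : word [::] = setT); last by apply/seteqP.
  rewrite preimage_setT setIT.
  under eq_integral do rewrite count_lawT.
  by rewrite integral_cst// mul1e.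
rewrite (_ : B `&` _ = (B `&` N t @^-1` [set k]) `&` tail (t + 1) @^-1` word v); last first.
  rewrite -setIA; congr (_ `&` _); apply/seteqP; split => w /=; rewrite (tail_scons t).
    rewrite -[word _ _]/((scons (N t w) @^-1` word (k :: v)) (tail (t + 1) w)).
    by rewrite scons_word; case: eqP.
  move=> [Nk vw].
  rewrite -[word _ _]/((scons (N t w) @^-1` word (k :: v)) (tail (t + 1) w)).
  by rewrite scons_word Nk eqxx.
rewrite ih; last exact: past_step.
pose h l j := count_law f (f (Num.max 0 l)%R j) (scons j @^-1` word (k :: v)).
have hE w : count_law f (lam t w) (word (k :: v)) = poisson_mean (lam t w) (h (lam t w)).
  rewrite (count_law_rec f0)//; last exact: measurable_word.
  by apply: eq_eseriesr => j _; rewrite /h max_r.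
under [RHS]eq_integral do rewrite hE.
rewrite -poisson_markov//; last first.
  move=> j; apply: (@measurable_count_law_step j).
  by apply: measurable_scons_preimage; exact: measurable_word.
rewrite integral_mkcondr; apply: eq_integral => w _; rewrite /h max_r// scons_word /patch.
rewrite (lamE (t + 1)) addrK; case: ifPn => [/set_mem/= ->|].
  by rewrite eqxx.
by rewrite notin_setE /= => /eqP/negbTE ->; rewrite measure0.
Qed.


Let kappa_ge0 : (0 <= kappa1 + kappa2)%R. Proof. exact: addr_ge0. Qed.

Let mixt t B (mB : measurable B) : exists m : {measure set seqT -> \bar R},
  forall C, m C = \int[P]_(w in B) count_law f (lam t w) C.
Proof.
unshelve eexists (mixture P B (fun w => count_law f (lam t w))
  : {measure set seqT -> \bar R}) => //.
move=> C mC; exact: measurable_count_law_lam.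
Qed.

Lemma tail_law t B (C : set seqT) : past t B -> measurable C ->
  P (B `&` tail t @^-1` C) = \int[P]_(w in B) count_law f (lam t w) C.
Proof.
move=> pB mC; have mB := past_measurable pB.
have [m2 m2E] := mixt t mB.
have [m1 m1E] : exists m : {measure set seqT -> \bar R},
    forall C, m C = P (B `&` tail t @^-1` C).
  unshelve eexists (pushforward (mrestr P mB) (tail t)
    : {measure set seqT -> \bar R}); first exact: measurable_tail.
  by move=> A; rewrite /= /pushforward /mrestr setIC.
rewrite -m1E -m2E; apply: seq_measure_unique => //.
  move=> w; rewrite m1E m2E.
  exact: tail_word.
rewrite m1E preimage_setT setIT.
by rewrite (le_lt_trans (probability_le1 _ _))// ltry.
Qed.

Lemma tail_shift_law t n B (C : set seqT) : past t B -> measurable C ->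
  P (B `&` tail (t + n%:Z) @^-1` C) =
  \int[P]_(w in B) count_law f (lam t w) (seq_shift n @^-1` C).
Proof.
move=> pB mC; rewrite -tail_law//; last exact: measurable_seq_shift_preimage.
have tailD w : tail (t + n%:Z) w = seq_shift n (tail t w).
  by apply/funext => i; rewrite /seq_shift /tail PoszD addrA.
by congr (P (_ `&` _)); apply/seteqP; split=> w /=; rewrite tailD.
Qed.

(** Stationarity is given on rectangles that fix each count; summing over the count leaves the
    intensity alone. *)
Lemma lam_stationary s t D : measurable D -> P (lam s @^-1` D) = P (lam t @^-1` D).
Proof.
move=> mD.
have one r k : P (\bigcap_(i in [set: 'I_1]) (N r @^-1` [set k] `&` lam r @^-1` D)) =
    P (N r @^-1` [set k] `&` lam r @^-1` D).
  congr (P _); apply/seteqP; split => [w h|w h i _//]; exact: (h ord0).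
have E r : P (lam r @^-1` D) = \sum_(k <oo) P (N r @^-1` [set k] `&` lam r @^-1` D).
  have mk k : measurable (N r @^-1` [set k] `&` lam r @^-1` D).
    by apply: measurableI => //; rewrite -[X in measurable X]setTI; exact: mlam.
  rewrite -measure_semi_bigcup//; last 2 first.
  - apply/trivIsetP => i j _ _ ij; apply/seteqP; split => // w [[/= wi _] [/= wj _]].
    by move: ij; rewrite -wi -wj eqxx.
  - exact: bigcupT_measurable.
  by congr (P _); apply/seteqP; split => [w Dw|w [k _ []]//]; exists (N r w).
rewrite !E; apply: eq_eseriesr => k _; rewrite -!one.
have := @stat (s - t)%R 1%N (fun=> t) (fun=> k) (fun=> D) (fun=> mD).
by rewrite addrC subrK.
Qed.

Lemma lam_integral_stationary s t (h : R -> \bar R) : measurable_fun setT h ->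
  (forall x, 0 <= h x) -> \int[P]_w h (lam s w) = \int[P]_w h (lam t w).
Proof.
move=> mh h0.
have E r : \int[P]_w h (lam r w) = \int[pushforward P (lam r)]_x h x.
  by rewrite ge0_integral_pushforward.
rewrite !E.
pose m r : {measure set R -> \bar R} := pushforward P (lam r).
apply: (@eq_measure_integral _ _ _ _ (pushforward P (lam t) : {measure set R -> \bar R})
  (pushforward P (lam s) : {measure set R -> \bar R})) => //.
by move=> A mA _; exact: lam_stationary.
Qed.

(** * Second moment of the intensity *)

Lemma lam_sqr_drift : exists rho D : R, [/\ (0 <= rho < 1)%R, (0 <= D)%R &
  forall t B, past t B -> \int[P]_(w in B) (lam (t + 1) w ^+ 2)%:E <=
    rho%:E * \int[P]_(w in B) (lam t w ^+ 2)%:E + D%:E].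
Proof.
have a0 : (0 <= f 0 0)%R by exact: f0.
have k01 : (0 <= kappa1 + kappa2 < 1)%R by rewrite kappa_ge0.
have [rho [D [r01 D0 drift]]] := drift_bound k01 a0 kappa2_ge0.
exists rho, D; split => // t B pB; have mB := past_measurable pB.
have r0 : (0 <= rho)%R by case/andP: r01.
(* The Lipschitz condition against the point (0, 0) bounds the next intensity by this affine form;
   its Poisson mean is what [drift_bound] controls. *)
pose h (l : R) (k : nat) := ((f 0 0%N + kappa1 * `|l| + kappa2 * k%:R) ^+ 2)%:E.
have h0 l k : 0 <= h l k by rewrite lee_fin sqr_ge0.
have mh k : measurable_fun setT (h ^~ k).
  apply/measurable_EFinP; apply: measurable_funX.
  apply: measurable_funD => //; apply: measurable_funD => //.
  by apply: measurable_funM => //; exact: normr_measurable.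
have mlam2 s : measurable_fun setT (fun w => (lam s w ^+ 2)%:E).
  by apply/measurable_EFinP; apply: measurable_funX.
have mlamN : measurable_fun setT (fun w => h (lam t w) (N t w)).
  apply: (@measurable_fun_nat_choice _ _ _ _ (fun k w => h (lam t w) k)) => //.
  by move=> k; exact: (measurableT_comp (mh k) (mlam t)).
apply: (@le_trans _ _ (\int[P]_(w in B) h (lam t w) (N t w))).
  apply: ge0_le_integral => //.
  - by move=> w _; rewrite lee_fin sqr_ge0.
  - exact: measurable_funTS.
  - exact: measurable_funTS.
  - move=> w _; rewrite lee_fin lamE addrK ler_sqr ?nnegrE ?f0//; last first.
      by rewrite !addr_ge0// mulr_ge0.
    have := flip (N t w) 0%N (lam0 t w) (lexx 0); rewrite !subr0 normr_nat.
    by move=> /(le_trans (ler_norm _)); lra.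
rewrite (poisson_markov pB mh h0).
have -> : rho%:E * \int[P]_(w in B) (lam t w ^+ 2)%:E =
    \int[P]_(w in B) (rho * lam t w ^+ 2)%:E.
  rewrite -ge0_integralZl_EFin//.
  - by move=> w _; rewrite lee_fin sqr_ge0.
  - exact: measurable_funTS.
apply: (@le_trans _ _ (\int[P]_(w in B) ((rho * lam t w ^+ 2)%:E + D%:E))).
  apply: ge0_le_integral => //.
  - by move=> w _; exact: poisson_mean_ge0.
  - apply: measurable_funTS; apply: ge0_emeasurable_sum.
      by move=> k w _ _; rewrite mule_ge0// lee_fin Poisson_pmf_ge0.
    move=> k _; apply: emeasurable_funM.
      apply/measurable_EFinP.
      exact: (measurableT_comp (measurable_Poisson_pmf k) (mlam t)).
    exact: (measurableT_comp (mh k) (mlam t)).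
  - apply: measurable_funTS; apply: emeasurable_funD => //; apply/measurable_EFinP.
    by apply: measurable_funM => //; exact: measurable_funX.
  move=> w _; rewrite /h ger0_norm// poisson_mean_sqr_affine//; last first.
    by rewrite addr_ge0// mulr_ge0.
  by rewrite -EFinD lee_fin -addrA -mulrDl; exact: drift.
rewrite ge0_integralD//; last 2 first.
- by move=> w _; rewrite lee_fin mulr_ge0// sqr_ge0.
- apply: measurable_funTS; apply/measurable_EFinP.
  by apply: measurable_funM => //; exact: measurable_funX.
rewrite leeD2l// integral_cst// -[leRHS]mule1 lee_wpmul2l//.
exact: probability_le1.
Qed.


Lemma lam_sqr_measurable s : measurable_fun setT (fun w => (lam s w ^+ 2)%:E).
Proof. by apply/measurable_EFinP; apply: measurable_funX. Qed.

Lemma lam_le_measurable s (K : R) : measurable [set w | (lam s w <= K)%R].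
Proof.
rewrite (_ : [set _ | _] = lam s @^-1` `]-oo, K]%classic); last first.
  by apply/seteqP; split => w /=; rewrite in_itv.
by rewrite -[X in measurable X]setTI; exact: mlam.
Qed.

Lemma integral_lam_sqr_le s (K : R) (B : set Omega) : measurable B ->
  (forall w, B w -> lam s w <= K)%R ->
  \int[P]_(w in B) (lam s w ^+ 2)%:E <= (K ^+ 2)%:E * P B.
Proof.
move=> mB BK; rewrite -integral_cst//; apply: ge0_le_integral => //.
- by move=> w _; rewrite lee_fin sqr_ge0.
- by apply: measurable_funTS; exact: lam_sqr_measurable.
- by move=> w /BK wK; rewrite lee_fin ler_sqr ?nnegrE// (le_trans _ wK).
Qed.

(* No moment is assumed: the drift is started from the event [lam s <= K] with
   [s] far in the past, and by stationarity the probability of its complement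
   depends on [K] only. *)
Lemma lam_sqr_lty : \int[P]_w (lam 1 w ^+ 2)%:E < +oo.
Proof.
have [rho [D [/andP[r0 r1] D0 drift]]] := lam_sqr_drift.
(* The fixed point of x -> rho x + D. *)
pose D' := (D / (1 - rho))%R.
have D'0 : (0 <= D')%R by rewrite divr_ge0// subr_ge0 ltW.
have D'E : (rho * D' + D = D')%R.
  by rewrite /D'; field; rewrite subr_eq0 eq_sym lt_eqF.
have iterated s (K : R) m : (0 <= K)%R ->
    \int[P]_(w in [set w | (lam s w <= K)%R]) (lam (s + m%:Z) w ^+ 2)%:E <=
    (rho ^+ m * K ^+ 2 + D')%:E.
  move=> K0; elim: m => [|m ih].
    rewrite addr0 expr0 mul1r.
    have le2 := @integral_lam_sqr_le s K _ (lam_le_measurable s K) (fun=> id).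
    apply: (le_trans le2).
    apply: (@le_trans _ _ (K ^+ 2)%:E); last by rewrite lee_fin lerDl D'0.
    rewrite -[leRHS]mule1; apply: lee_wpmul2l; rewrite ?lee_fin ?sqr_ge0//.
    exact/probability_le1/lam_le_measurable.
  have -> : (s + m.+1%:Z = s + m%:Z + 1)%R by lia.
  have pK : past (s + m%:Z) [set w | (lam s w <= K)%R].
    rewrite (_ : [set _ | _] = lam s @^-1` `]-oo, K]%classic).
      by apply: past_lam => //; lia.
    by apply/seteqP; split => w /=; rewrite in_itv.
  apply: le_trans (drift _ _ pK) _.
  apply: (@le_trans _ _ (rho%:E * (rho ^+ m * K ^+ 2 + D')%:E + D%:E)).
    by apply: leeD2r; apply: lee_wpmul2l.
  by rewrite -EFinM -EFinD lee_fin mulrDr mulrA -exprS -addrA D'E.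
pose F n := [set w | (n%:R < lam 1 w)%R].
have mF n : measurable (F n).
  rewrite (_ : F n = ~` [set w | (lam 1 w <= n%:R)%R]).
    by apply: measurableC; exact: lam_le_measurable.
  by apply/seteqP; split => w; rewrite /F /= ltNge => /negP.
have F0 : P (F n) @[n --> \oo] --> 0.
  have <- : P (\bigcap_n F n) = 0.
    rewrite (_ : \bigcap_n F n = set0) ?measure0//; apply/seteqP; split => // w Fw.
    have := Fw (Num.bound (lam 1 w)) I; rewrite /F /= ltNge => /negP; apply.
    exact/ltW/archi_boundP.
  apply: nonincreasing_cvg_mu => //.
  - by rewrite (le_lt_trans (probability_le1 _ _))// ltry.
  - exact: bigcapT_measurable.
  - move=> n m nm; apply/subsetPset => w; rewrite /F /=.
    by apply: le_lt_trans; rewrite ler_nat.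
(* A bound uniform in the truncation level [J]. Where lam s <= n, the iterated drift gives D' +
   rho^m n^2; elsewhere the integrand is at most J^2 and the probability is that of [F n]. So [n] is
   chosen from [J] and [e], then [m] from [n], and s = 1 - m. *)
have key (J : R) : (0 <= J)%R ->
    \int[P]_(w in [set w | (lam 1 w <= J)%R]) (lam 1 w ^+ 2)%:E <= D'%:E.
  move=> J0; apply/lee_addgt0Pr => e e0.
  have [n Fn] : exists n, (J ^+ 2)%:E * P (F n) <= (e / 2)%:E.
    have : (J ^+ 2)%:E * P (F n) @[n --> \oo] --> 0.
      by rewrite -[X in _ --> X](mule0 (J ^+ 2)%:E); exact: cvgeMl.
    move=> /fine_cvgP[/= [n1 _ fin] /cvgrPdist_le/(_ (e / 2)%R)].
    rewrite divr_gt0// => /(_ isT)[n2 _ n2P].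
    exists (maxn n1 n2); have := n2P (maxn n1 n2) (leq_maxr _ _).
    rewrite sub0r normrN => /(le_trans (ler_norm _)).
    by rewrite -lee_fin fineK//; apply: fin; exact: leq_maxl.
  have [m mP] : exists m, (rho ^+ m * n%:R ^+ 2 <= e / 2)%R.
    have : (rho ^+ m * n%:R ^+ 2)%R @[m --> \oo] --> (0 : R)%R.
      rewrite -[X in _ --> X](mul0r ((n%:R : R) ^+ 2)%R); apply: cvgMl.
      by apply: cvg_expr; rewrite ger0_norm.
    move=> /cvgrPdist_le/(_ (e / 2)%R); rewrite divr_gt0// => /(_ isT)[m _ mP].
    exists m; have := mP m (leqnn _).
    by rewrite sub0r normrN => /(le_trans (ler_norm _)).
  pose s := (1 - m%:Z)%R; pose B := [set w | (lam s w <= n%:R)%R].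
  pose E := [set w | (lam 1 w <= J)%R].
  have mB : measurable B by exact: lam_le_measurable.
  have mE : measurable E by exact: lam_le_measurable.
  have -> : [set w | (lam 1 w <= J)%R] = (E `&` B) `|` (E `\` B).
    by rewrite setUIDK.
  have mEB := measurableI _ _ mE mB.
  have mEDB := measurableD mE mB.
  rewrite ge0_integral_setU//; last 3 first.
  - by apply: measurable_funTS; exact: lam_sqr_measurable.
  - by move=> w _; rewrite lee_fin sqr_ge0.
  - by apply/disj_setPS => w [[_ Bw] [_ nBw]].
  have -> : D'%:E + e%:E = (D' + e / 2)%:E + (e / 2)%:E.
    by rewrite -!EFinD; congr EFin; lra.
  apply: leeD.
    apply: (@le_trans _ _ (\int[P]_(w in B) (lam 1 w ^+ 2)%:E)).
      apply: ge0_subset_integral => //.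
      - by apply: measurable_funTS; exact: lam_sqr_measurable.
      - by move=> w _; rewrite lee_fin sqr_ge0.
    have := iterated s n%:R m (ler0n _ _); rewrite /s subrK => /le_trans; apply.
    by rewrite lee_fin; lra.
  apply: le_trans (@integral_lam_sqr_le 1 J _ mEDB _) _; first by move=> w [].
  apply: le_trans Fn; apply: lee_wpmul2l; rewrite ?lee_fin ?sqr_ge0//.
  apply: (@le_trans _ _ (P (~` B))).
    by apply: le_measure; rewrite ?inE//; exact: measurableC.
  have -> : ~` B = lam s @^-1` `]n%:R, +oo[%classic.
    by apply/seteqP; split => w; rewrite /B /= in_itv/= andbT ltNge => /negP.
  rewrite (lam_stationary s 1)// le_eqVlt; apply/orP; left; apply/eqP.
  by congr (P _); apply/seteqP; split => w; rewrite /F /= in_itv/= andbT.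
apply: (@le_lt_trans _ _ D'%:E); last by rewrite ltry.
pose G n := [set w | (lam 1 w <= n%:R)%R].
have GT : \bigcup_n G n = setT.
  apply/seteqP; split => // w _; exists (Num.bound (lam 1 w)) => //.
  exact/ltW/archi_boundP.
have /cvg_lim <- // : \int[P]_(w in G n) (lam 1 w ^+ 2)%:E @[n --> \oo] -->
    \int[P]_w (lam 1 w ^+ 2)%:E.
  rewrite -[X in _ --> \int[P]_(w in X) _]GT.
  apply: ge0_nondecreasing_set_cvg_integral => //.
  - move=> n m nm; apply/subsetPset => w; rewrite /G /= => /le_trans; apply.
    by rewrite ler_nat.
  - by move=> n; exact: lam_le_measurable.
  - by move=> n; apply: measurable_funTS; exact: lam_sqr_measurable.
  - by move=> n w _; rewrite lee_fin sqr_ge0.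
apply: lime_le.
  apply: ereal_nondecreasing_is_cvgn => n m nm; apply: ge0_subset_integral => //.
  - exact: lam_le_measurable.
  - exact: lam_le_measurable.
  - by apply: measurable_funTS; exact: lam_sqr_measurable.
  - by move=> w _; rewrite lee_fin sqr_ge0.
  - by move=> w; rewrite /G /= => /le_trans; apply; rewrite ler_nat.
by apply: nearW => n; apply: key.
Qed.

(** * Recovering the intensity from the past counts *)

Lemma lam_measurableE s : measurable_fun setT (fun w => (lam s w)%:E).
Proof. exact/measurable_EFinP. Qed.

Lemma lam_lty : \int[P]_w (lam 1 w)%:E < +oo.
Proof.
apply: (@le_lt_trans _ _ (\int[P]_w ((lam 1 w ^+ 2)%:E + 1))).
  apply: ge0_le_integral => //.
  - by move=> w _; rewrite lee_fin.
  - exact: lam_measurableE.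
  - by apply: emeasurable_funD => //; exact: lam_sqr_measurable.
  - by move=> w _; rewrite -EFinD lee_fin -subr_ge0; have := sqr_ge0 (lam 1 w - 1/2); lra.
rewrite ge0_integralD//; last 2 first.
- by move=> w _; rewrite lee_fin sqr_ge0.
- exact: lam_sqr_measurable.
by rewrite integral_cst// mul1e lte_add_pinfty// ?lam_sqr_lty// ltey_eq fin_num_measure.
Qed.

Lemma lam_integral s : \int[P]_w (lam s w)%:E = \int[P]_w (lam 1 w)%:E.
Proof.
have h r : \int[P]_w (lam r w)%:E = \int[P]_w (`|lam r w|)%:E.
  by apply: eq_integral => w _; rewrite ger0_norm.
rewrite !h; apply: (lam_integral_stationary s 1 (h := fun x => `|x|%:E)) => //.
by apply/measurable_EFinP; exact: normr_measurable.
Qed.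

(* [n] steps of the recursion started from intensity 0, along the past counts
   [x 0] (the most recent one), [x 1], ... *)
Fixpoint back (n : nat) (x : nat -> nat) : R :=
  if n is m.+1 then f (back m (seq_shift 1 x)) (x 0%N) else 0%R.

Definition hist (t : int) : Omega -> seqT := fun w i => N (t - 1 - i%:Z) w.

(** An upper limit, [fine] and the maximum with 0 make this total, measurable and nonnegative on
    every sequence; where [back] converges to a nonnegative real it is the limit. *)
Definition recon (x : nat -> nat) : R :=
  Num.max 0%R (fine (limn_esup (fun n => (back n x)%:E))).

Lemma back_ge0 n x : (0 <= back n x)%R.
Proof. by elim: n x => //= n ih x; exact: f0. Qed.

(** [back n] depends on finitely many counts only. [S] is arbitrary because the induction pulls it
    back along [f] with the count fixed. *)
Lemma measurable_back n (S : set R) : measurable (back n @^-1` S : set seqT).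
Proof.
elim: n S => [|n ih] S.
  have [S0|S0] := pselect (S 0%R).
    by rewrite (_ : _ @^-1` _ = setT)//; apply/seteqP; split.
  by rewrite (_ : _ @^-1` _ = set0)//; apply/seteqP; split.
rewrite (_ : _ @^-1` _ = \bigcup_k ([set x | x 0%N = k] `&`
    seq_shift 1 @^-1` (back n @^-1` [set r | S (f r k)]))); last first.
  by apply/seteqP; split => [x Sx|x [k _ [/= <-]]//]; exists (x 0%N).
apply: bigcupT_measurable => k; apply: measurableI; first exact: measurable_coord.
by apply: measurable_seq_shift_preimage; exact: ih.
Qed.

Lemma measurable_recon : measurable_fun setT (recon : seqT -> R).
Proof.
apply: measurable_maxr => //.
apply: (measurableT_comp (fine_measurable measurableT)).
apply: measurable_fun_limn_esup => n; apply/measurable_EFinP => _ S _.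
by rewrite setTI; exact: measurable_back.
Qed.

Lemma recon_ge0 x : (0 <= recon x)%R.
Proof. by rewrite le_max lexx. Qed.

(** Both recursions read the same counts, so only [kappa1] enters. *)
Lemma lam_back n t w :
  (`|lam t w - back n (hist t w)| <= kappa1 ^+ n * lam (t - n%:Z) w)%R.
Proof.
elim: n t => [|n ih] t /=; first by rewrite !subr0 expr0 mul1r ger0_norm.
have -> : seq_shift 1 (hist t w) = hist (t - 1) w.
  by apply/funext => i; rewrite /seq_shift /hist; congr (N _ w); lia.
have -> : hist t w 0%N = N (t - 1) w by rewrite /hist subr0.
rewrite lamE.
have := flip (N (t - 1) w) (N (t - 1) w) (lam0 (t - 1) w) (back_ge0 n (hist (t - 1) w)).
rewrite subrr normr0 mulr0 addr0 => /le_trans; apply.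
rewrite exprS -mulrA ler_wpM2l//; apply: le_trans (ih _) _.
by rewrite (_ : t - 1 - n%:Z = t - n.+1%:Z)%R//; lia.
Qed.

Lemma kappa1_lt1 : (kappa1 < 1)%R.
Proof. by apply: le_lt_trans kappa_lt1; rewrite lerDl. Qed.

(** The terms have expectations kappa1^n E lambda_1, which are summable; the series is almost surely
    finite and its terms tend to 0. *)
Lemma lam_decay t : {ae P, forall w,
  (kappa1 ^+ n * lam (t - n%:Z) w)%R @[n --> \oo] --> (0 : R)%R}.
Proof.
pose u n w := (kappa1 ^+ n * lam (t - n%:Z) w)%:E.
have u0 n w : 0 <= u n w by rewrite lee_fin mulr_ge0// exprn_ge0.
have mu n : measurable_fun setT (u n).
  by apply/measurable_EFinP; apply: measurable_funM.
have mS : measurable_fun setT (fun w => \sum_(n <oo) u n w).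
  by apply: ge0_emeasurable_sum.
have S0 w : 0 <= \sum_(n <oo) u n w by exact: nneseries_ge0.
have Sfin : \int[P]_w \sum_(n <oo) u n w < +oo.
  rewrite integral_nneseries//.
  have uE n : \int[P]_w u n w = (kappa1 ^+ n)%:E * \int[P]_w (lam 1 w)%:E.
    rewrite -(lam_integral (t - n%:Z)) -ge0_integralZl_EFin//.
    - by move=> w _; rewrite lee_fin.
    - exact: lam_measurableE.
    - exact: exprn_ge0.
  have Efin : \int[P]_w (lam 1 w)%:E \is a fin_num.
    by rewrite ge0_fin_numE ?lam_lty// integral_ge0// => w _; rewrite lee_fin.
  apply: (@le_lt_trans _ _ (((1 - kappa1)^-1)%:E * \int[P]_w (lam 1 w)%:E)); last first.
    by rewrite -(fineK Efin) -EFinM ltry.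
  apply: lime_le.
    by apply: is_cvg_nneseries => n _ _; exact: integral_ge0.
  apply: nearW => m; under eq_bigr do rewrite uE.
  rewrite -ge0_sume_distrl; last by move=> n _; rewrite lee_fin exprn_ge0.
  apply: lee_wpmul2r; first by apply: integral_ge0 => w _; rewrite lee_fin.
  have k1 : (0 < 1 - kappa1)%R by rewrite subr_gt0; exact: kappa1_lt1.
  rewrite sumEFin lee_fin big_mkord -[leRHS]mul1r ler_pdivlMr// mulrC.
  by rewrite -opprB mulNr -subrX1 opprB gerBl exprn_ge0.
have : P.-integrable setT (fun w => \sum_(n <oo) u n w).
  apply/integrableP; split => //.
  by under eq_integral do rewrite gee0_abs//.
move=> /integrable_ae -/(_ measurableT); apply: filterS => w /(_ I) Sw.
have Swoo : \sum_(n <oo) u n w < +oo by rewrite -ge0_fin_numE.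
have tail0 := nneseries_tail_cvg Swoo (fun n _ => u0 n w).
have : u n w @[n --> \oo] --> 0.
  apply: (squeeze_cvge _ (@cvg_cst _ 0 _ _ _) tail0).
  apply: nearW => n; rewrite u0 /=.
  rewrite (nneseries_split _ 1)// addn1 big_nat1 leeDl//.
  exact: nneseries_ge0.
by move=> /fine_cvgP[_].
Qed.

Lemma lam_recon t : {ae P, forall w, lam t w = recon (hist t w)}.
Proof.
have := lam_decay t; apply: filterS => w decay.
have backl : back n (hist t w) @[n --> \oo] --> lam t w.
  apply/cvgrPdist_le => e e0; have := decay => /cvgrPdist_le/(_ e e0).
  apply: filterS => n; rewrite sub0r normrN => /(le_trans (ler_norm _)).
  exact/le_trans/lam_back.
have backE : (back n (hist t w))%:E @[n --> \oo] --> (lam t w)%:E.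
  by apply: cvg_EFin; [exact: nearW|exact: backl].
by rewrite /recon (cvg_limn_einf_sup backE).2 /= max_r.
Qed.

(** * The conditional law of the future given the past counts *)

Let past0_gen : set (set Omega) :=
  [set A | exists (s : int) m, (s <= 0)%R /\ A = N s @^-1` [set m]].

Lemma past_sigma_past : past_sigma N `<=` past 1.
Proof.
apply: smallest_sub; first exact: smallest_sigma_algebra.
by move=> _ [s [m [s0 ->]]]; apply: past_N; rewrite subrr.
Qed.

Lemma past_sigma_measurable : past_sigma N `<=` measurable.
Proof. exact: subset_trans past_sigma_past (@past_measurable 1). Qed.

Lemma past_sigma_hist (C : set seqT) : measurable C ->
  past_sigma N (hist 1 @^-1` C).
Proof.
move=> mC; have mh : measurable_fun setT (hist 1 : g_sigma_algebraType past0_gen -> seqT).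
  apply: measurable_fun_seqT => i k; apply: sub_gen_smallest.
  by exists (1 - 1 - i%:Z)%R, k; split => //; lia.
by have := mh measurableT _ mC; rewrite setTI.
Qed.

(** Written with [recon] instead of [lam 1], since it must be measurable in the past counts at every
    point. The law starts at time 1, so time [n] is reached after n - 1 steps. *)
Definition rcd_kernel (n : nat) (w : Omega) (C : set (nat -> nat)) : R :=
  fine (count_law f (recon (hist 1 w)) (seq_shift n.-1 @^-1` C)).

Lemma count_law_fin l (C : set seqT) : measurable C -> count_law f l C \is a fin_num.
Proof.
move=> mC; rewrite ge0_fin_numE//; apply: le_lt_trans (ltry 1).
exact: count_law_le1.
Qed.

Lemma rcd_kernel_past n (C : set seqT) : measurable C ->
  sub_measurable (past_sigma N) (fun w => rcd_kernel n w C).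
Proof.
move=> mC B mB; have mC' := measurable_seq_shift_preimage n.-1 mC.
have mg : measurable_fun setT
    (fun x : seqT => fine (count_law f (Num.max 0%R (recon x)) (seq_shift n.-1 @^-1` C))).
  apply: (measurableT_comp (fine_measurable measurableT)).
  exact: (measurableT_comp (measurable_count_law mC') measurable_recon).
have := past_sigma_hist (mg measurableT _ mB).
rewrite (_ : _ @^-1` _ = (rcd_kernel n ^~ C) @^-1` B)//.
by rewrite setTI; apply/seteqP; split => w /=; rewrite max_r// recon_ge0.
Qed.

Lemma tail_predn n : (0 < n)%N -> tail (1 + n.-1%:Z) = tail n%:Z.
Proof. by move=> n0; congr tail; lia. Qed.

Lemma rcd_kernel_ae n (C : set seqT) : measurable C ->
  {ae P, forall w, (rcd_kernel n w C)%:E = count_law f (lam 1 w) (seq_shift n.-1 @^-1` C)}.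
Proof.
move=> mC; have := lam_recon 1; apply: filterS => w ->.
by rewrite /rcd_kernel fineK// count_law_fin//; exact: measurable_seq_shift_preimage.
Qed.

Lemma rcd_kernel_measurable n (C : set seqT) : measurable C ->
  measurable_fun setT (fun w => (rcd_kernel n w C)%:E).
Proof.
move=> mC; apply/measurable_EFinP => _ B mB; rewrite setTI.
by apply: past_sigma_measurable; exact: rcd_kernel_past.
Qed.

Lemma rcd_kernel_integral n (C : set seqT) B : (0 < n)%N -> measurable C ->
  past_sigma N B -> \int[P]_(w in B) (rcd_kernel n w C)%:E = P (B `&` future N n @^-1` C).
Proof.
move=> n0 mC pB; have mB := past_sigma_measurable pB.
rewrite -[future N n]/(tail n%:Z) -tail_predn// tail_shift_law//; last exact: past_sigma_past.
apply: ae_eq_integral => //.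
- by apply: measurable_funTS; exact: rcd_kernel_measurable.
- apply: measurable_funTS; apply: measurable_count_law_lam.
  exact: measurable_seq_shift_preimage.
- by have := rcd_kernel_ae n mC; apply: filterS => w ->.
Qed.

Lemma rcd_kernel_measure n w : exists m : {measure set seqT -> \bar R},
  forall C : set seqT, measurable C -> m C = (rcd_kernel n w C)%:E.
Proof.
unshelve eexists (pushforward (count_law f (recon (hist 1 w)))
   (seq_shift n.-1 : seqT -> seqT) : {measure set seqT -> \bar R}).
  exact: measurable_seq_shift.
move=> C mC; rewrite /= /pushforward /rcd_kernel fineK//.
by apply: count_law_fin; exact: measurable_seq_shift_preimage.
Qed.

Lemma rcd_kernel_is_rcd n : (0 < n)%N -> is_rcd P N n (rcd_kernel n).
Proof.
move=> n0; split.
- by move=> w; rewrite /rcd_kernel preimage_setT count_lawT.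
- by move=> w C mC; rewrite fine_ge0.
- move=> w F mF tF; have [m mE] := rcd_kernel_measure n w.
  have mU : measurable (\bigcup_i F i : set seqT) by exact: bigcupT_measurable.
  have := @measure_semi_sigma_additive _ _ _ m F mF tF mU.
  rewrite mE// => /fine_cvg; apply: cvg_trans; apply: near_eq_cvg.
  apply: nearW => k /=; rewrite big_mkord.
  rewrite (eq_bigr (fun i : 'I_k => (rcd_kernel n w (F i))%:E)) ?sumEFin//.
  by move=> i _; rewrite (mE _ (mF i)).
- by move=> C mC; exact: rcd_kernel_past.
- by move=> C B mC pB; exact: rcd_kernel_integral.
Qed.

Lemma is_rcd_measure n Q w : is_rcd P N n Q ->
  exists m : {measure set seqT -> \bar R},
    forall C : set seqT, measurable C -> m C = (Q w C)%:E.
Proof.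
move=> [QT Q0 Qsigma _ _].
(* Sigma-additivity for the constant family [set0]: the partial sums m a converge, so their
   increment [a] is 0. *)
have Qset0 : Q w set0 = 0%R.
  have s0 : seq_sigma set0 by exact: (@measurable0 _ seqT).
  have h := Qsigma w (fun=> set0) (fun=> s0) (@trivIset_set0 _ _ _).
  rewrite bigcup0// in h; set a := Q w set0 in h *.
  have h' : (\sum_(i < m.+1) a)%R @[m --> \oo] --> a.
    by move: h; rewrite -(cvg_shiftS (fun m => \sum_(i < m) a)%R).
  have : ((\sum_(i < m.+1) a) - (\sum_(i < m) a))%R @[m --> \oo] --> (a - a)%R.
    exact: cvgB.
  rewrite subrr (_ : (fun _ => _) = cst a); last first.
    by apply/funext => m; rewrite big_ord_recr/= addrAC subrr add0r.
  by move=> /(cvg_lim (@Rhausdorff R)) <-; rewrite lim_cst.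
(* The absolute value gives a nonnegative function on all sets; on events it changes nothing. *)
pose m (C : set seqT) := (`|Q w C|)%:E.
have m0 : m set0 = 0 by rewrite /m Qset0 normr0.
have mge0 C : 0 <= m C by rewrite lee_fin.
have msigma : semi_sigma_additive m.
  move=> F mF tF mU; rewrite /m ger0_norm ?Q0//.
  apply: cvg_EFin.
    apply: nearW => k; rewrite sumEFin//.
  have := Qsigma w F mF tF; apply: cvg_trans; apply: near_eq_cvg.
  apply: nearW => k /=; rewrite sumEFin/= big_mkord.
  apply: eq_bigr => i _; rewrite ger0_norm//.
  by apply: Q0; exact: mF.
pose mix := isMeasure.Build _ _ _ m m0 mge0 msigma.
pose mm : {measure set seqT -> \bar R} := HB.pack m mix.
by exists mm => C mC; rewrite /= /m ger0_norm// Q0.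
Qed.

(** For each word, both versions have the same integrals over past events and agree almost
    everywhere. The words are countable, so one null set serves them all, and outside it the
    measures coincide. *)
Lemma is_rcd_unique n Q : (0 < n)%N -> is_rcd P N n Q ->
  {ae P, forall w, forall C, seq_sigma C -> Q w C = rcd_kernel n w C}.
Proof.
move=> n0 rcdQ; have [QT Q0 Qsigma Qpast Qint] := rcdQ.
(* Equality of integrals is known on past events only, so the comparison is made on [Omega] with
   that smaller sigma-field. *)
pose S : measurableType _ := g_sigma_algebraType past0_gen.
have mid : measurable_fun setT (id : Omega -> S).
  by move=> _ B mB; rewrite setTI; exact: past_sigma_measurable.
have [PS PSE intE] : exists2 PS : {measure set S -> \bar R}, forall A, PS A = P A &
    forall (g : S -> \bar R) B, measurable_fun setT g -> (forall w, 0 <= g w) ->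
      measurable B -> \int[PS]_(w in B) g w = \int[P]_(w in B) g w.
  unshelve eexists (pushforward P (id : Omega -> S) : {measure set S -> \bar R}) => //.
  move=> g B mg g0 mB; rewrite ge0_integral_pushforward//.
  exact: measurable_funTS.
have ae_word v : {ae P, forall w, Q w (word v) = rcd_kernel n w (word v)}.
  have mv := measurable_word v.
  have mQ : measurable_fun setT ((fun w => (Q w (word v))%:E) : S -> \bar R).
    by apply/measurable_EFinP => _ B mB; rewrite setTI; exact: Qpast.
  have mK : measurable_fun setT ((fun w => (rcd_kernel n w (word v))%:E) : S -> \bar R).
    apply/measurable_EFinP => _ B mB; rewrite setTI.
    exact: rcd_kernel_past.
  have Q00 w : 0 <= (Q w (word v))%:E by rewrite lee_fin; exact: Q0.
  have K00 w : 0 <= (rcd_kernel n w (word v))%:E by rewrite lee_fin fine_ge0.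
  have iK : PS.-integrable setT (fun w => (rcd_kernel n w (word v))%:E).
    apply/integrableP; split => //.
    under eq_integral do rewrite gee0_abs//.
    rewrite intE// rcd_kernel_integral//; last exact: (@measurableT _ S).
    apply: le_lt_trans (ltry 1); apply: probability_le1; rewrite setTI.
    by rewrite -[X in measurable X]setTI; exact: (measurable_tail n%:Z).
  have := @integral_ae_eq _ _ _ PS setT measurableT _ _ iK mQ.
  have hE E : E `<=` setT -> measurable E ->
      \int[PS]_(x in E) (rcd_kernel n x (word v))%:E = \int[PS]_(x in E) (Q x (word v))%:E.
    by move=> _ mE; rewrite !intE// rcd_kernel_integral// Qint.
  move=> /(_ hE) [Z [mZ PZ ZE]].
  exists Z; split; [exact: past_sigma_measurable|by rewrite -PSE|].
  by move=> w /= nw; apply: ZE => /= h; apply: nw; have [] := h I.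
have : {ae P, forall w, forall j, let v := odflt [::] (unpickle j) in
    Q w (word v) = rcd_kernel n w (word v)}.
  by apply/ae_foralln => j; exact: ae_word.
apply: filterS => w hw C mC; apply/EFin_inj.
have [m1 m1E] := is_rcd_measure w rcdQ.
have [m2 m2E] := rcd_kernel_measure n w.
rewrite -m1E// -m2E//; apply: seq_measure_unique => //.
  move=> v; rewrite m1E; last exact: measurable_word.
  rewrite m2E; last exact: measurable_word.
  by have := hw (pickle v); rewrite pickleK /= => ->.
by rewrite m1E// QT ltry.
Qed.

(** * Bound on the mixing coefficients *)

Let elam := \int[P]_w (lam 1 w)%:E.

Lemma elam_fin : elam \is a fin_num.
Proof.
by rewrite ge0_fin_numE ?lam_lty// integral_ge0// => w _; rewrite lee_fin.
Qed.

Lemma integral_cstP (c : \bar R) : \int[P]_w (cst c w) = c.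
Proof.
rewrite integral_cst// -[RHS]mule1; congr (_ * _); exact: probability_setT.
Qed.

Definition beta_rate (n : nat) : R := ((kappa1 + kappa2) ^+ n.-1 / (1 - kappa1))%R.

Lemma beta_rate_ge0 n : (0 <= beta_rate n)%R.
Proof.
rewrite mulr_ge0 ?exprn_ge0// invr_ge0 subr_ge0 ltW//; exact: kappa1_lt1.
Qed.

(** The unconditional probability is the mean of the conditional one over [lam 1], and |l - lam 1|
    <= l + lam 1. Integrating [l] as well produces the factor 2. *)
Lemma count_law_mean_dist n l (C : set seqT) : (0 < n)%N -> (0 <= l)%R -> measurable C ->
  `|count_law f l (seq_shift n.-1 @^-1` C) - P (tail n%:Z @^-1` C)| <=
  (beta_rate n * l)%:E + (beta_rate n)%:E * elam.
Proof.
move=> n0 l0 mC; have mC' := measurable_seq_shift_preimage n.-1 mC.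
have b0 := beta_rate_ge0 n.
have lip := count_law_shift_lipschitz f0 kappa1_ge0 kappa2_ge0 kappa_lt1 flip n.-1 mC.
rewrite -/(beta_rate n) in lip.
have FE : P (tail n%:Z @^-1` C) =
    \int[P]_w count_law f (lam 1 w) (seq_shift n.-1 @^-1` C).
  rewrite -tail_predn// -(@tail_shift_law 1 n.-1 setT C) ?setTI//.
  exact: (@measurableT _ (g_sigma_algebraType _)).
have mlaw := measurable_count_law_lam 1 mC'.
have law0 l' : 0 <= count_law f l' (seq_shift n.-1 @^-1` C) by [].
have Cfin := count_law_fin l mC'.
have mblam : measurable_fun setT (fun w => (beta_rate n * lam 1 w)%:E).
  by apply/measurable_EFinP; exact: measurable_funM.
have intb : \int[P]_w (beta_rate n * lam 1 w)%:E = (beta_rate n)%:E * elam.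
  rewrite -ge0_integralZl_EFin//.
  - by move=> w _; rewrite lee_fin.
  - exact: lam_measurableE.
have dist x y : (0 <= x)%R -> (0 <= y)%R ->
    count_law f x (seq_shift n.-1 @^-1` C) <=
    count_law f y (seq_shift n.-1 @^-1` C) + (beta_rate n * x + beta_rate n * y)%:E.
  move=> x0 y0; apply: le_trans (lip x y x0 y0) _; rewrite leeD2l// lee_fin.
  rewrite -mulrDr ler_wpM2l//; apply: le_trans (ler_normB _ _) _.
  by rewrite !ger0_norm.
have Ffin : P (tail n%:Z @^-1` C) \is a fin_num.
  apply: fin_num_measure; rewrite -[X in measurable X]setTI.
  exact: measurable_tail.
have up : count_law f l (seq_shift n.-1 @^-1` C) <=
    P (tail n%:Z @^-1` C) + ((beta_rate n * l)%:E + (beta_rate n)%:E * elam).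
  have -> : count_law f l (seq_shift n.-1 @^-1` C) =
      \int[P]_w (cst (count_law f l (seq_shift n.-1 @^-1` C)) w).
    by rewrite integral_cstP.
  have -> : (beta_rate n * l)%:E = \int[P]_w (cst (beta_rate n * l)%:E w).
    by rewrite integral_cstP.
  rewrite FE -intb -ge0_integralD//; last 2 first.
  - by move=> w _; rewrite lee_fin mulr_ge0.
  - by move=> w _; rewrite lee_fin mulr_ge0.
  rewrite -ge0_integralD//; last 2 first.
  - by move=> w _; rewrite adde_ge0// lee_fin mulr_ge0.
  - exact: emeasurable_funD.
  apply: ge0_le_integral => //.
  - by apply: emeasurable_funD => //; exact: emeasurable_funD.
  - by move=> w _; rewrite /cst -EFinD; exact: dist.
have dn : P (tail n%:Z @^-1` C) <= count_law f l (seq_shift n.-1 @^-1` C) +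
    ((beta_rate n * l)%:E + (beta_rate n)%:E * elam).
  have -> : count_law f l (seq_shift n.-1 @^-1` C) =
      \int[P]_w (cst (count_law f l (seq_shift n.-1 @^-1` C)) w).
    by rewrite integral_cstP.
  have -> : (beta_rate n * l)%:E = \int[P]_w (cst (beta_rate n * l)%:E w).
    by rewrite integral_cstP.
  rewrite FE -intb -ge0_integralD//; last 2 first.
  - by move=> w _; rewrite lee_fin mulr_ge0.
  - by move=> w _; rewrite lee_fin mulr_ge0.
  rewrite -ge0_integralD//; last 2 first.
  - by move=> w _; rewrite adde_ge0// lee_fin mulr_ge0.
  - exact: emeasurable_funD.
  apply: ge0_le_integral => //.
  - by apply: emeasurable_funD => //; exact: emeasurable_funD.
  - by move=> w _; rewrite /cst -EFinD [X in X%:E]addrC; exact: dist.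
move: up dn Ffin Cfin; rewrite -(fineK elam_fin).
case: (P _) => [p||]//; case: (count_law _ _ _) => [c||]//= up dn _ _.
move: up dn; rewrite -EFinM -!EFinD !lee_fin /= => up dn.
by rewrite ler_norml; apply/andP; split; lra.
Qed.

Lemma beta_sup_ge0 n Q w : 0 <= beta_sup P N n Q w.
Proof.
apply: (@le_trans _ _ `|(Q w set0)%:E - P (future N n @^-1` set0)|) => //.
by apply: ereal_sup_ubound; exists set0 => //; exact: (@measurable0 _ seqT).
Qed.

(** Outside one null set, common to all events, [Q] is the kernel at [lam 1]; the supremum is then
    below a measurable function of [lam 1]. *)
Lemma rcd_beta_le n Q : (0 < n)%N -> is_rcd P N n Q ->
  beta_coef P N n Q <= (2 * (kappa1 + kappa2) ^+ n.-1 / (1 - kappa1))%:E * elam.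
Proof.
move=> n0 rcdQ; have b0 := beta_rate_ge0 n.
have mblam : measurable_fun setT (fun w => (beta_rate n * lam 1 w)%:E).
  by apply/measurable_EFinP; exact: measurable_funM.
have elam0 : 0 <= elam by apply: integral_ge0 => w _; rewrite lee_fin.
apply: (@le_trans _ _ (\int[P]_w ((beta_rate n * lam 1 w)%:E + (beta_rate n)%:E * elam))).
  apply: ge0_le_integral_ae.
  - by move=> w; exact: beta_sup_ge0.
  - move=> w; apply: adde_ge0; first by rewrite lee_fin mulr_ge0.
    by apply: mule_ge0 => //; rewrite lee_fin.
  - exact: emeasurable_funD.
  have := lam_recon 1; apply: filterS2 (is_rcd_unique n0 rcdQ) => w Qw lw.
  apply: ge_ereal_sup => _ [C mC <-].
  rewrite Qw// /rcd_kernel fineK; last first.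
    by apply: count_law_fin; exact: measurable_seq_shift_preimage.
  by rewrite -lw; exact: count_law_mean_dist.
rewrite ge0_integralD//; last 2 first.
- by move=> w _; rewrite lee_fin mulr_ge0.
- by move=> w _; apply: mule_ge0 => //; rewrite lee_fin.
rewrite (integral_cstP ((beta_rate n)%:E * elam)).
under eq_integral do rewrite EFinM.
rewrite ge0_integralZl_EFin//; last 2 first.
- by move=> w _; rewrite lee_fin.
- exact: lam_measurableE.
rewrite -/elam -(fineK elam_fin) -!EFinM -EFinD lee_fin /beta_rate.
by rewrite le_eqVlt; apply/orP; left; apply/eqP; ring.
Qed.

(** The covariance form of the bound, obtained by integrating [count_law_mean_dist] over [B]; it
    drives the mixing below. *)
Let law_bound n B (C : set seqT) : (0 < n)%N -> past 1 B -> measurable C ->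
  `|P (B `&` tail n%:Z @^-1` C) - P B * P (tail n%:Z @^-1` C)| <=
  (2 * beta_rate n)%:E * elam.
Proof.
move=> n0 pB mC; have mB := past_measurable pB; have b0 := beta_rate_ge0 n.
have mC' := measurable_seq_shift_preimage n.-1 mC.
have mlaw := measurable_count_law_lam 1 mC'.
have mF : measurable (tail n%:Z @^-1` C).
  by rewrite -[X in measurable X]setTI; exact: measurable_tail.
set F := P (tail n%:Z @^-1` C).
have Ffin : F \is a fin_num by exact: fin_num_measure.
have F0 : 0 <= F by exact: measure_ge0.
have elam0 : 0 <= elam by apply: integral_ge0 => w _; rewrite lee_fin.
pose D w := (beta_rate n * lam 1 w)%:E + (beta_rate n)%:E * elam.
have D0 w : 0 <= D w.
  by rewrite adde_ge0 ?mule_ge0// lee_fin mulr_ge0.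
have mD : measurable_fun setT D.
  apply: emeasurable_funD => //; apply/measurable_EFinP; exact: measurable_funM.
have intD : \int[P]_(w in B) D w <= (2 * beta_rate n)%:E * elam.
  apply: (@le_trans _ _ (\int[P]_w D w)).
    by apply: ge0_subset_integral.
  rewrite /D ge0_integralD//; last 3 first.
  - by move=> w _; rewrite lee_fin mulr_ge0.
  - by apply/measurable_EFinP; exact: measurable_funM.
  - by move=> w _; apply: mule_ge0 => //; rewrite lee_fin.
  rewrite (integral_cstP ((beta_rate n)%:E * elam)).
  under eq_integral do rewrite EFinM.
  rewrite ge0_integralZl_EFin//; last 2 first.
  - by move=> w _; rewrite lee_fin.
  - exact: lam_measurableE.
  rewrite -/elam -(fineK elam_fin) -!EFinM -EFinD lee_fin.
  by rewrite le_eqVlt; apply/orP; left; apply/eqP; ring.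
have PBF : P B * F = \int[P]_(w in B) (cst F w) by rewrite integral_cst// muleC.
have PE : P (B `&` tail n%:Z @^-1` C) =
    \int[P]_(w in B) count_law f (lam 1 w) (seq_shift n.-1 @^-1` C).
  by rewrite -tail_predn// tail_shift_law.
have dist w := count_law_mean_dist n0 (lam0 1 w) mC.
have lfin w := count_law_fin (lam 1 w) mC'.
have up : P (B `&` tail n%:Z @^-1` C) <= P B * F + (2 * beta_rate n)%:E * elam.
  apply: (@le_trans _ _ (P B * F + \int[P]_(w in B) D w)); last by rewrite leeD2l.
  rewrite PE PBF -ge0_integralD//; last exact: measurable_funTS.
  apply: ge0_le_integral => //.
  - exact: measurable_funTS.
  - by apply: measurable_funTS; exact: emeasurable_funD.
  - move=> w _; rewrite addeC -leeBlDr// (le_trans (lee_abs _))//.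
    exact: dist.
have dn : P B * F <= P (B `&` tail n%:Z @^-1` C) + (2 * beta_rate n)%:E * elam.
  apply: (@le_trans _ _ (P (B `&` tail n%:Z @^-1` C) + \int[P]_(w in B) D w)); last first.
    by rewrite leeD2l.
  rewrite PE PBF -ge0_integralD//; last 2 first.
  - exact: measurable_funTS.
  - exact: measurable_funTS.
  apply: ge0_le_integral => //.
  - by apply: measurable_funTS; exact: emeasurable_funD.
  - move=> w _; rewrite addeC -leeBlDr// (le_trans (lee_abs _))//.
    rewrite -abseN fin_num_oppeB// addeC; exact: dist.
have PBCfin : P (B `&` tail n%:Z @^-1` C) \is a fin_num.
  by apply: fin_num_measure; exact: measurableI.
have PBfin : P B \is a fin_num by exact: fin_num_measure.
move: up dn; rewrite -(fineK PBCfin) -(fineK PBfin) -(fineK Ffin) -(fineK elam_fin).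
rewrite -!EFinM -EFinB -!EFinD !lee_fin /= => up dn.
by rewrite ler_norml; apply/andP; split; lra.
Qed.

(** * Mixing of the count process *)

Definition path_from (h : int) : Omega -> intT := fun w t => N (t + h) w.

Lemma measurable_path_from h : measurable_fun setT (path_from h).
Proof. by apply: measurable_fun_intT => t k; exact: mN. Qed.

Lemma path_from_cyl_stationary h s :
  P (path_from h @^-1` cyl s) = P (path_from 0 @^-1` cyl s).
Proof.
have E r : P (path_from r @^-1` cyl s) = P (\bigcap_(i in [set: 'I_(size s)])
    (N ((nth (0%R, 0%N) s i).1 + r) @^-1` [set (nth (0%R, 0%N) s i).2] `&`
     lam ((nth (0%R, 0%N) s i).1 + r) @^-1` setT)).
  congr (P _); apply/seteqP; split=> [w ws i _|w ws p ps].
    by split => //; apply: ws; exact: mem_nth.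
  have ip : (index p s < size s)%N by rewrite index_mem.
  by have [] := ws (Ordinal ip) I; rewrite /= nth_index.
rewrite !E.
have := @stat h (size s) (fun i => (nth (0%R, 0%N) s i).1)
  (fun i => (nth (0%R, 0%N) s i).2) (fun=> setT) (fun=> measurableT).
by move=> ->; congr (P _); apply: eq_bigcapr => i _; rewrite addr0.
Qed.

Let path_from_measure h : exists m : {measure set intT -> \bar R},
  forall A, m A = P (path_from h @^-1` A).
Proof.
unshelve eexists (pushforward P (path_from h) : {measure set intT -> \bar R}) => //.
exact: measurable_path_from.
Qed.

Lemma path_from_preimage h (A : set intT) : measurable A ->
  measurable (path_from h @^-1` A).
Proof. by move=> mA; rewrite -[X in measurable X]setTI; exact: measurable_path_from. Qed.

Lemma path_from_stationary h (A : set intT) : measurable A ->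
  P (path_from h @^-1` A) = P (path_from 0 @^-1` A).
Proof.
have [m1 m1E] := path_from_measure h; have [m2 m2E] := path_from_measure 0.
rewrite -m1E -m2E => mA.
have cylT : cyls setT by exists [::]; rewrite cyl_nil.
apply: (@measure_unique _ R intT (cyls : set (set intT)) (fun=> setT)
  measurable_cyls cyls_setI) => //.
- by apply/seteqP; split => // x _; exists 0%N.
- by move=> _ [s ->]; rewrite m1E m2E path_from_cyl_stationary.
- by move=> k; rewrite m1E preimage_setT; apply: le_lt_trans (ltry 1); exact: probability_le1.
Qed.

(** With [m] bounding all times involved, a translation by -m puts the first cylinder at times <= 0
    and the second at times >= h - 2m, where [law_bound] applies. *)
Lemma path_from_cyl_mixing s s' :
  fine (P (path_from 0 @^-1` cyl s `&` path_from h%:Z @^-1` cyl s')) @[h --> \oo] -->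
  (fine (P (path_from 0 @^-1` cyl s)) * fine (P (path_from 0 @^-1` cyl s')))%R.
Proof.
have [m mP] : exists m : nat, forall p, p \in s ++ s' -> (`|p.1| <= m)%N.
  exists (\max_(p <- s ++ s') `|p.1|)%N => p ps.
  exact: (@leq_bigmax_seq _ _ xpredT (fun p : int * nat => `|p.1|%N)).
have ms p : p \in s -> (p.1 <= m%:Z)%R.
  by move=> ps; have := mP p; rewrite mem_cat ps => /(_ isT); lia.
have ms' p : p \in s' -> (- m%:Z <= p.1)%R.
  by move=> ps; have := mP p; rewrite mem_cat ps orbT => /(_ isT); lia.
pose B := path_from (- m%:Z) @^-1` cyl s.
have pB : past 1 B.
  rewrite /B; elim: s ms {mP B} => [|p s ih] ms.
    rewrite cyl_nil preimage_setT.
    exact: (@measurableT _ (g_sigma_algebraType _)).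
  rewrite cyl_cons preimage_setI; apply: sigma_algebraI_gen.
    rewrite (_ : _ @^-1` _ = N (p.1 - m%:Z) @^-1` [set p.2])//.
    by apply: past_N; rewrite subrr subr_le0; apply: ms; exact: mem_head.
  by apply: ih => q qs; apply: ms; rewrite inE qs orbT.
(* The second cylinder, reindexed from time -m; p.1 + m is nonnegative, so the absolute value is
   only a cast. *)
pose C : set seqT := [set x | forall p, p \in s' -> x `|(p.1 + m%:Z)%R|%N = p.2].
have mC : measurable C.
  rewrite /C; elim: s' {mP ms' C} => [|p s' ih].
    by rewrite (_ : [set _ | _] = setT)//; apply/seteqP.
  rewrite (_ : [set _ | _] = [set x | x `|(p.1 + m%:Z)%R|%N = p.2] `&`
      [set x | forall p, p \in s' -> x `|(p.1 + m%:Z)%R|%N = p.2]).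
    by apply: (@measurableI _ seqT) => //; exact: measurable_coord.
  apply/seteqP; split => x.
    by move=> h; split => [|q qs]; apply: h; rewrite inE ?eqxx ?qs ?orbT.
  by move=> [h1 h2] q; rewrite inE => /orP[/eqP ->|/h2].
have tailE n : tail n%:Z @^-1` C = path_from (n%:Z + m%:Z) @^-1` cyl s'.
  apply/seteqP; split => w h p ps; have := h p ps; rewrite /tail /path_from;
    have := ms' p ps => mp;
    by rewrite (_ : n%:Z + `|(p.1 + m%:Z)%R|%N%:Z = p.1 + (n%:Z + m%:Z))%R//; lia.
have PE h : (2 * m < h)%N ->
    P (path_from 0 @^-1` cyl s `&` path_from h%:Z @^-1` cyl s') =
    P (B `&` tail (h - 2 * m)%N%:Z @^-1` C).
  move=> mh; rewrite tailE.
  pose sh := map (fun p : int * nat => ((p.1 + h%:Z)%R, p.2)) s'.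
  have shE r : path_from r @^-1` cyl sh = path_from (r + h%:Z) @^-1` cyl s'.
    apply/seteqP; split => w /= ws p.
      move=> ps; have := ws ((p.1 + h%:Z)%R, p.2).
      rewrite /path_from /= => <-; first by rewrite -addrA (addrC h%:Z).
      by apply/mapP; exists p.
    move=> /mapP[q qs ->] /=; rewrite -(ws q qs) /path_from.
    by rewrite -addrA (addrC h%:Z).
  rewrite (_ : path_from h%:Z @^-1` cyl s' = path_from 0 @^-1` cyl sh); last first.
    by rewrite shE add0r.
  rewrite -preimage_setI -cyl_cat -(path_from_cyl_stationary (- m%:Z)).
  rewrite cyl_cat preimage_setI shE.
  by rewrite (_ : - m%:Z + h%:Z = (h - 2 * m)%N%:Z + m%:Z)%R//; lia.
have PBE : P B = P (path_from 0 @^-1` cyl s) by exact: path_from_cyl_stationary.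
have PCE n : P (tail n%:Z @^-1` C) = P (path_from 0 @^-1` cyl s').
  by rewrite tailE path_from_cyl_stationary.
pose e := fine elam.
have rate0 : (2 * beta_rate (h - 2 * m) * e)%R @[h --> \oo] --> (0 : R)%R.
  have k01 : (`|kappa1 + kappa2| < 1)%R by rewrite ger0_norm.
  rewrite -(cvg_shiftn (2 * m).+1); rewrite (_ : (fun _ => _) =
    (fun h => 2 * e / (1 - kappa1) * (kappa1 + kappa2) ^+ h)%R); last first.
    apply/funext => h; rewrite /beta_rate.
    rewrite (_ : (h + (2 * m).+1 - 2 * m).-1 = h)%N; last by lia.
    by ring.
  have : (2 * e / (1 - kappa1) * (kappa1 + kappa2) ^+ h)%R @[h --> \oo] -->
      (2 * e / (1 - kappa1) * 0)%R.
    by apply: cvgMr; exact: cvg_expr.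
  by rewrite mulr0.
apply/cvgrPdist_le => eps eps0.
move: rate0 => /cvgrPdist_le/(_ eps eps0); apply: filterS2 (nbhs_infty_gt (2 * m)).
move=> h mh; rewrite sub0r normrN => /(le_trans (ler_norm _)); apply: le_trans.
have n0 : (0 < h - 2 * m)%N by rewrite subn_gt0.
have := law_bound n0 pB mC; rewrite PCE PBE PE// distrC.
have f1 : P (path_from 0 @^-1` cyl s) \is a fin_num.
  by apply: fin_num_measure; apply: path_from_preimage; exact: measurable_cyl.
have f2 : P (path_from 0 @^-1` cyl s') \is a fin_num.
  by apply: fin_num_measure; apply: path_from_preimage; exact: measurable_cyl.
have f3 : P (B `&` tail (h - 2 * m)%N%:Z @^-1` C) \is a fin_num.
  apply: fin_num_measure; apply: measurableI; first exact: past_measurable pB.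
  by rewrite -[X in measurable X]setTI; exact: measurable_tail.
rewrite -(fineK f1) -(fineK f2) -(fineK f3) -(fineK elam_fin) /=.
by rewrite -!EFinM lee_fin.
Qed.

Let fin_path_from h (A : set intT) : measurable A ->
  P (path_from h @^-1` A) \is a fin_num.
Proof. by move=> mA; apply: fin_num_measure; exact: path_from_preimage. Qed.

Let path_from_le h (A : set intT) (B : set Omega) : measurable A -> measurable B ->
  P (B `&` path_from h @^-1` A) <= P (path_from 0 @^-1` A).
Proof.
move=> mA mB; rewrite -(path_from_stationary h mA).
have mhA := path_from_preimage h mA.
by apply: le_measure; rewrite ?inE//; exact: measurableI.
Qed.

Let restricted_path_measure h (B : set Omega) : measurable B ->
  exists m : {measure set intT -> \bar R}, forall A, m A = P (B `&` path_from h @^-1` A).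
Proof.
move=> mB; unshelve eexists (pushforward (mrestr P mB) (path_from h)
  : {measure set intT -> \bar R}); first exact: measurable_path_from.
by move=> A; rewrite /= /pushforward /mrestr setIC.
Qed.

Let scaled_path_measure (p : R) : (0 <= p)%R ->
  exists m : {measure set intT -> \bar R}, forall A, m A = p%:E * P (path_from 0 @^-1` A).
Proof.
move=> p0; have [m1 m1E] := path_from_measure 0.
by exists (mscale (NngNum p0) m1) => A; rewrite /= /mscale /= m1E.
Qed.

Let mixing_closure (B : nat -> set Omega) (h : nat -> int) (p : R) :
  (0 <= p <= 1)%R -> (forall n, measurable (B n)) ->
  (forall s, fine (P (B n `&` path_from (h n) @^-1` cyl s)) @[n --> \oo] -->
     (p * fine (P (path_from 0 @^-1` cyl s)))%R) ->
  forall A : set intT, measurable A ->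
  fine (P (B n `&` path_from (h n) @^-1` A)) @[n --> \oo] -->
     (p * fine (P (path_from 0 @^-1` A)))%R.
Proof.
move=> /andP[p0 p1] mB cylcvg A mA.
have [phi phiE] := choice (fun n => restricted_path_measure (h n) (mB n)).
have [psi psiE] := scaled_path_measure p0.
have [mu muE] := path_from_measure 0.
have psifine A' : measurable A' ->
    (p * fine (P (path_from 0 @^-1` A')) = fine (psi A'))%R.
  by move=> mA'; rewrite psiE fineM// fin_path_from.
rewrite psifine//; under eq_fun do rewrite -phiE.
apply: (@cvg_dominated_measures _ intT R cyls phi psi mu) => //.
- exact: measurable_cyls.
- exact: cyls_setI.
- by exists [::]; rewrite cyl_nil.
- rewrite muE preimage_setT; apply: le_lt_trans (ltry 1); exact: probability_le1.
- by move=> n A' mA'; rewrite phiE muE; exact: path_from_le.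
- move=> A' mA'; rewrite psiE muE -[leRHS]mul1e; apply: lee_wpmul2r => //.
- move=> _ [s ->]; rewrite -psifine; last exact: measurable_cyl.
  by under eq_fun do rewrite phiE; exact: cylcvg.
Qed.

(** [mixing_closure] replaces cylinders by events one side at a time: for [B] with [A] fixed, then
    for [A] with the cylinder moving and no shift. *)
Lemma path_from_mixing (A B : set intT) : measurable A -> measurable B ->
  fine (P (path_from 0 @^-1` A `&` path_from h%:Z @^-1` B)) @[h --> \oo] -->
  (fine (P (path_from 0 @^-1` A)) * fine (P (path_from 0 @^-1` B)))%R.
Proof.
have prob01 (E : set intT) : measurable E -> (0 <= fine (P (path_from 0 @^-1` E)) <= 1)%R.
  move=> mE; rewrite fine_ge0//= -lee_fin fineK ?fin_path_from//.
  by apply: probability_le1; exact: path_from_preimage.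
move=> mA mB.
apply: (@mixing_closure (fun=> path_from 0 @^-1` A) (fun h => h%:Z)) => //.
- exact: prob01.
- by move=> _; exact: path_from_preimage.
move=> s; rewrite mulrC.
under eq_fun do rewrite setIC.
apply: (@mixing_closure (fun h : nat => path_from h%:Z @^-1` cyl s) (fun=> 0%R)) => //.
- by apply: prob01; exact: measurable_cyl.
- by move=> n; apply: path_from_preimage; exact: measurable_cyl.
by move=> s'; rewrite mulrC; under eq_fun do rewrite setIC; exact: path_from_cyl_mixing.
Qed.

Lemma path_from_invariant (A : set intT) : measurable A ->
  A = [set x | A (fun t => x (t + 1)%R)] ->
  P (path_from 0 @^-1` A) = 0 \/ P (path_from 0 @^-1` A) = 1.
Proof.
move=> mA invA.
have invx x : A x = A (fun t => x (t + 1)%R) by rewrite {1}invA.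
have inv h : path_from h%:Z @^-1` A = path_from 0 @^-1` A.
  elim: h => [//|h ih]; rewrite -ih; apply/funext => w; rewrite /preimage/= [RHS]invx.
  congr (A _); apply/funext => t; rewrite /path_from; congr (N _ w); lia.
have := path_from_mixing mA mA.
under eq_fun do rewrite inv setIid.
move=> /(cvg_lim (@Rhausdorff R)); rewrite lim_cst//.
have := fin_path_from 0 mA; move: (P _) => [p _ /=|//|//].
move=> /eqP; rewrite -subr_eq0 -{1}(mulr1 p) -mulrBr mulf_eq0 => /orP[/eqP ->|].
  by left.
by rewrite subr_eq0 => /eqP <-; right.
Qed.

(** * Ergodicity of the joint process *)

Definition path_gen : set (set (int -> nat * R)) :=
  [set A | exists (t : int) (k : nat), A = [set x | (x t).1 = k]] `|`
  [set A | exists (t : int) (B : set R), measurable B /\ A = [set x | B (x t).2]].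

Notation pathT := (g_sigma_algebraType path_gen).

(** Using the same [recon] at all times makes this commute with the shift at every path, so an
    invariant event pulls back to an exactly invariant event of counts. *)
Definition extend (x : intT) : pathT :=
  fun t => (x t, recon (fun i => x (t - 1 - i%:Z)%R)).

Lemma measurable_fun_pathT d' (T : measurableType d') (g : T -> pathT) :
  (forall t k, measurable [set x | (g x t).1 = k]) ->
  (forall t, measurable_fun setT (fun x => (g x t).2)) -> measurable_fun setT g.
Proof.
move=> h1 h2; apply: (measurability (path_gen : set (set pathT))) => //.
move=> _ [_ [[t [k ->]]|[t [B [mB ->]]]] <-]; rewrite setTI; first exact: h1.
by rewrite -[X in measurable X]setTI; exact: h2.
Qed.

Lemma measurable_extend : measurable_fun setT extend.
Proof.
apply: measurable_fun_pathT => [t k|t]; first exact: measurable_int_coord.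
apply: (measurableT_comp measurable_recon).
by apply: measurable_fun_seqT => i k; exact: measurable_int_coord.
Qed.

Lemma process_ergodic : ergodic P N lam.
Proof.
move=> C pC invC A; rewrite /A {A}.
have mC : measurable (C : set pathT) by [].
pose C' : set intT := extend @^-1` C.
have mC' : measurable C'.
  by rewrite -[X in measurable X]setTI; exact: measurable_extend.
have invC' : C' = [set x | C' (fun t => x (t + 1)%R)].
  have invx x : C x = C (fun t => x (t + 1)%R) by rewrite {1}invC.
  apply/funext => x; rewrite /C' /preimage /= invx; congr (C _).
  apply/funext => t; rewrite /extend; congr (_, recon _).
  by apply/funext => i; congr (x _); lia.
have mW : measurable_fun setT ((fun w t => (N t w, lam t w)) : Omega -> pathT).
  by apply: measurable_fun_pathT => [t k|t]; [exact: mN|exact: mlam].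
have mA : measurable ((fun w t => (N t w, lam t w)) @^-1` C).
  by rewrite -[X in measurable X]setTI; exact: mW.
suff -> : P ((fun w t => (N t w, lam t w)) @^-1` C) = P (path_from 0 @^-1` C').
  exact: path_from_invariant.
have mA' := path_from_preimage 0 mC'.
rewrite -[X in P X]setIT -[in RHS](setIT (path_from 0 @^-1` C')) -!integral_indic//.
apply: ae_eq_integral => //.
- exact/measurable_EFinP.
- exact/measurable_EFinP.
(* Enumerating the integers gives one null set for all times. *)
have : {ae P, forall w, forall j, let t := odflt 0%R (unpickle j) in
    lam t w = recon (hist t w)}.
  by apply/ae_foralln => j; exact: lam_recon.
apply: filterS => w hw _; rewrite !indicE; congr ((nat_of_bool _)%:R%:E).
suff E : (fun t => (N t w, lam t w)) = extend (path_from 0 w).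
  by apply/idP/idP => /set_mem h; apply/mem_set; move: h; rewrite /C' /= E.
apply/funext => t; rewrite /extend /path_from addr0; congr (_, _).
have := hw (pickle t); rewrite pickleK /= => ->.
by congr recon; apply/funext => i; rewrite /hist addr0.
Qed.

Lemma beta_coef_cvg (Qs : nat -> Omega -> set (nat -> nat) -> R) :
  (forall n, is_rcd P N n (Qs n)) ->
  beta_coef P N n (Qs n) @[n --> \oo] --> 0.
Proof.
move=> rcdQ; pose c := (2 / (1 - kappa1) * fine elam)%R.
have c0 : (c * (kappa1 + kappa2) ^+ n.-1)%:E @[n --> \oo] --> 0.
  rewrite -(cvg_shiftn 1%N); under eq_fun do rewrite addn1 /=.
  apply: cvg_EFin; first exact: nearW.
  have : (c * (kappa1 + kappa2) ^+ n)%R @[n --> \oo] --> (c * 0)%R.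
    by apply: cvgMr; apply: cvg_expr; rewrite ger0_norm.
  by rewrite mulr0.
apply: (squeeze_cvge _ (@cvg_cst _ 0 _ _ _) c0).
apply: filterS (nbhs_infty_gt 0) => n n0; apply/andP; split.
  by apply: integral_ge0 => w _; exact: beta_sup_ge0.
apply: le_trans (rcd_beta_le n0 (rcdQ n)) _.
rewrite -(fineK elam_fin) -EFinM lee_fin /c.
by rewrite le_eqVlt; apply/orP; left; apply/eqP; ring.
Qed.

Lemma recon_preimage (B : set R) : measurable B -> seq_sigma (recon @^-1` B).
Proof. by move=> mB; have := measurable_recon measurableT mB; rewrite setTI. Qed.

End process.

Unset Implicit Arguments.

Theorem theorem3p1 (d : measure_display) (Omega : measurableType d)
  (R : realType) (P : probability Omega R)
  (f : R -> nat -> R) (kappa1 kappa2 : R)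
  (N : int -> Omega -> nat) (lam : int -> Omega -> R) :
  (* f : [0,oo) x N_0 -> [0,oo), contractive Lipschitz condition *)
  (forall l y, 0 <= l -> 0 <= f l y) ->
  0 <= kappa1 -> 0 <= kappa2 -> kappa1 + kappa2 < 1 ->
  (forall l l' (y y' : nat), 0 <= l -> 0 <= l' ->
     `|f l y - f l' y'| <= kappa1 * `|l - l'| + kappa2 * `|y%:R - y'%:R|) ->
  (* the process: random variables with values in N_0 x [0,oo) *)
  (forall t k, measurable (N t @^-1` [set k])) ->
  (forall t, measurable_fun setT (lam t)) ->
  (forall t w, 0 <= lam t w) ->
  strictly_stationary P N lam ->
  (* lambda_t = f(lambda_{t-1}, N_{t-1}) *)
  (forall t w, lam t w = f (lam (t - 1) w) (N (t - 1) w)) ->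
  (* N_t | sigma(lambda_t; lambda_s, N_s, s <= t-1) ~ Poisson(lambda_t) *)
  (forall t (k : nat) B,
     gen_sigma N lam [set s | s <= t - 1] [set s | s <= t] B ->
     P (B `&` N t @^-1` [set k]) =
       (\int[P]_(w in B) (Poisson_pmf_at (lam t w) k)%:E)%E) ->
  let kappa := kappa1 + kappa2 in
  (* (i) absolute regularity with the stated bound on beta(n) *)
  ((forall n : nat, (0 < n)%N ->
      (exists Q, is_rcd P N n Q) /\
      (forall Q, is_rcd P N n Q ->
         (beta_coef P N n Q <=
           ((2 * kappa ^+ n.-1 / (1 - kappa1))%:E * \int[P]_w (lam 1 w)%:E))%E)) /\
   (forall Qs : nat -> Omega -> set (nat -> nat) -> R,
      (forall n, is_rcd P N n (Qs n)) ->
      (fun n => beta_coef P N n (Qs n)) @ \oo --> 0%E)) /\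
  (* (ii) lambda_t is a measurable function of the past counts *)
  (exists g : (nat -> nat) -> R,
     (forall x, 0 <= g x) /\
     (forall B : set R, measurable B -> seq_sigma (g @^-1` B)) /\
     (forall t : int,
        {ae P, forall w, lam t w = g (fun i : nat => N (t - 1 - i%:Z) w)})) /\
  (* (iii) ergodicity *)
  ergodic P N lam /\
  (* (iv) E lambda_1^2 < oo *)
  (\int[P]_w ((lam 1 w) ^+ 2)%:E < +oo)%E.
Proof.
move=> f0 k1 k2 klt flip mN mlam lam0 stat lamE poissonN kappa.
split; [split=> [n n0|Qs rcdQ]|split; [|split]].
- split.
    exists (rcd_kernel f N n).
    exact: (rcd_kernel_is_rcd f0 k1 k2 klt flip mN mlam lam0 stat lamE poissonN n0).
  move=> Q.
  exact: (rcd_beta_le f0 k1 k2 klt flip mN mlam lam0 stat lamE poissonN n0).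
- exact: (beta_coef_cvg f0 k1 k2 klt flip mN mlam lam0 stat lamE poissonN rcdQ).
- exists (recon f); split; [exact: recon_ge0|split; [exact: recon_preimage|]].
  exact: (lam_recon f0 k1 k2 klt flip mN mlam lam0 stat lamE poissonN).
- exact: (process_ergodic f0 k1 k2 klt flip mN mlam lam0 stat lamE poissonN).
- exact: (lam_sqr_lty f0 k1 k2 klt flip mN mlam lam0 stat lamE poissonN).
Qed.
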